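(* Suppose $G$ is a finite group with $NK_1(\mathbb{Z}G)\neq 0$, and $A$ is a $G$-primitive matrix over $\mathbb{Z}_+G$ with spectral radius $\lambda>1$ such that the elementary stabilizer $E(A,\mathbb{Z}G)$ is trivial. Then there is an infinite family $\{A_i : i\in\mathbb{N}\}$ of $G$-primitive matrices which are pairwise not strong shift equivalent over $\mathbb{Z}G$ but such that for all $i$ the following hold: (1) $A_i$ is shift equivalent over $\mathbb{Z}_+G$ to $A$. (2) $\overline{A_i}$ is strong shift equivalent over $\mathbb{Z}_+$ to $\overline A$. (3) If $G$ is abelian, then $\det(I-tA_i)=\det(I-tA)$.
   Context: $\mathbb{Z}G$ is the integral group ring and $\mathbb{Z}_+G$ is the set of elements $\sum_g n_g g$ with all $n_g\ge0$. A square matrix $A$ over $\mathbb{Z}_+G$ is $G$-primitive if for some $k>0$ every entry of $A^k$ has the form $\sum_g n_g g$ with $n_g>0$ for every $g\in G$. $\overline A$ is the matrix obtained by applying the augmentation $\sum_g n_g g\mapsto\sum_g n_g$ entrywise. The spectral radius of a square matrix $A$ over $\mathbb{Z}G$ is that of the integer matrix $\overline A$. Let $\mathcal S$ be a semiring (with 0 and 1). Square matrices $A,B$ (possibly of different sizes) are elementary strong shift equivalent over $\mathcal S$ if there are matrices $R,S$ over $\mathcal S$ with $A=RS$, $B=SR$; strong shift equivalence (SSE) over $\mathcal S$ is the transitive closure of this relation. $A,B$ are shift equivalent (SE) over $\mathcal S$ if there are $\ell\in\mathbb{N}$ and matrices $R,S$ over $\mathcal S$ with $A^\ell=RS$, $B^\ell=SR$,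 $AR=RB$, $SA=BS$. For a ring $R$, $K_1(R)=\mathrm{GL}(R)/\mathrm{El}(R)$, where $\mathrm{GL}(R)=\varinjlim \mathrm{GL}_n(R)$ and $\mathrm{El}(R)=\varinjlim\mathrm{El}_n(R)$ is the subgroup generated by elementary matrices; $NK_1(R)$ is the kernel of the map $K_1(R[t])\to K_1(R)$ induced by $t\mapsto 0$. For a square matrix $A$ over $R$, the elementary stabilizer $E(A,R)$ is the subgroup of $NK_1(R)$ consisting of the elements $[U]$ with $U\in\mathrm{GL}(R[t])$ such that there exists $E\in\mathrm{El}(R[t])$ with $U(I-tA)=(I-tA)E$, where $I-tA$ is stabilized to an infinite matrix by direct sum with an infinite identity matrix. *)

(* Defs.v *)
From HB Require Import structures.
From mathcomp Require Import all_boot all_order all_algebra all_fingroup all_field.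
From mathcomp Require Import classical_sets.

Set Implicit Arguments.
Unset Strict Implicit.
Unset Printing Implicit Defensive.

Import Order.TTheory GRing.Theory Num.Theory.
Local Open Scope ring_scope.
Local Open Scope classical_set_scope.

(* The element \sum_g n_g g of the group (semi)ring is the finite function    *)
(* g |-> n_g.  The alias is needed because {ffun gT -> K} already carries the *)
(* pointwise product, whereas here the product is the convolution.            *)
Definition grpring (K : Type) (gT : finGroupType) : Type := {ffun gT -> K}.

Section GroupSemiring.
Variables (K : nzSemiRingType) (gT : finGroupType).
Local Notation KG := (grpring K gT).

HB.instance Definition _ := GRing.Nmodule.on KG.

Definition grpring_one : KG := [ffun g => (g == 1%g)%:R].
Definition grpring_mul (x y : KG) : KG :=
  [ffun g => \sum_(h : gT) x h * y (h^-1 * g)%g].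

Fact grpring_mulA : associative grpring_mul.
Proof.
move=> x y z; apply/ffunP=> g; rewrite !ffunE.
under eq_bigr => h _ do rewrite ffunE mulr_sumr.
under [RHS]eq_bigr => h _ do rewrite ffunE mulr_suml.
rewrite [RHS]exchange_big; apply: eq_bigr => h _ /=.
rewrite [RHS](reindex_inj (mulgI h)); apply: eq_bigr => k _ /=.
by rewrite mulKg invMg -mulgA mulrA.
Qed.

Fact grpring_mul1 : left_id grpring_one grpring_mul.
Proof.
move=> x; apply/ffunP=> g; rewrite ffunE (bigD1 1%g) //= big1 => [|h /negPf h1].
  by rewrite ffunE eqxx mul1r invg1 mul1g addr0.
by rewrite ffunE h1 mul0r.
Qed.

Fact grpring_mulr1 : right_id grpring_one grpring_mul.
Proof.
move=> x; apply/ffunP=> g; rewrite ffunE (bigD1 g) //= big1 => [|h hg].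
  by rewrite ffunE mulVg eqxx mulr1 addr0.
by rewrite ffunE -eq_mulVg1 (negPf hg) mulr0.
Qed.

Fact grpring_mulDl : left_distributive grpring_mul +%R.
Proof.
move=> x y z; apply/ffunP=> g; rewrite !ffunE -big_split.
by apply: eq_bigr => h _; rewrite ffunE mulrDl.
Qed.

Fact grpring_mulDr : right_distributive grpring_mul +%R.
Proof.
move=> x y z; apply/ffunP=> g; rewrite !ffunE -big_split.
by apply: eq_bigr => h _; rewrite ffunE mulrDr.
Qed.

Fact grpring_mul0 : left_zero 0 grpring_mul.
Proof.
move=> x; apply/ffunP=> g; rewrite !ffunE big1 // => h _.
by rewrite ffunE mul0r.
Qed.

Fact grpring_mulr0 : right_zero 0 grpring_mul.
Proof.
move=> x; apply/ffunP=> g; rewrite !ffunE big1 // => h _.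
by rewrite ffunE mulr0.
Qed.

Fact grpring_one_neq0 : grpring_one != 0.
Proof.
by apply/eqP => /ffunP/(_ 1%g); rewrite !ffunE eqxx; apply/eqP/oner_neq0.
Qed.

HB.instance Definition _ := GRing.Nmodule_isNzSemiRing.Build KG
  grpring_mulA grpring_mul1 grpring_mulr1 grpring_mulDl grpring_mulDr
  grpring_mul0 grpring_mulr0 grpring_one_neq0.

Definition augmentation (x : KG) : K := \sum_(g : gT) x g.

End GroupSemiring.

HB.instance Definition _ (K : nzRingType) (gT : finGroupType) :=
  GRing.Zmodule.on (grpring K gT).

Definition ZG (gT : finGroupType) : nzRingType := grpring int gT.

(* Z_+G is the group semiring with coefficients in Z_+ = nat; ZG_of is its    *)
(* inclusion in ZG.                                                           *)
Definition ZpG (gT : finGroupType) : nzSemiRingType := grpring nat gT.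
Definition ZG_of (gT : finGroupType) (x : ZpG gT) : ZG gT :=
  [ffun g => (x g)%:Z].

Definition G_primitive (gT : finGroupType) (n : nat) (A : 'M[ZpG gT]_n) : Prop :=
  exists2 k : nat, (0 < k)%N &
    forall (i j : 'I_n) (g : gT), (0 < (A ^+ k) i j g)%N.

(* Complex eigenvalues of an integer matrix are algebraic, hence algC.        *)
Definition is_spectral_radius (gT : finGroupType) (n : nat) (A : 'M[ZG gT]_n)
    (lambda : algC) : Prop :=
  let Abar : 'M[algC]_n := map_mx intr (map_mx (@augmentation int gT) A) in
  (exists2 z : algC, eigenvalue Abar z & `|z| = lambda) /\
  (forall z : algC, eigenvalue Abar z -> `|z| <= lambda).

Section ShiftEquivalence.
Variable S : pzSemiRingType.

Definition ESSE (m n : nat) (A : 'M[S]_m) (B : 'M[S]_n) : Prop :=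
  exists (U : 'M[S]_(m, n)) (V : 'M[S]_(n, m)), A = U *m V /\ B = V *m U.

Inductive SSE (m n : nat) (A : 'M[S]_m) (B : 'M[S]_n) : Prop :=
| SSE_step of ESSE A B
| SSE_trans (p : nat) (C : 'M[S]_p) of SSE A C & SSE C B.

Definition SE (m n : nat) (A : 'M[S]_m) (B : 'M[S]_n) : Prop :=
  exists (l : nat) (U : 'M[S]_(m, n)) (V : 'M[S]_(n, m)), (0 < l)%N /\
    [/\ A ^+ l = U *m V, B ^+ l = V *m U, A *m U = U *m B & V *m A = B *m V].

End ShiftEquivalence.

(* For n <= N, the direct sum of M with an identity matrix of size N - n      *)
(* (see stab_block).                                                          *)
Definition stab (R : pzRingType) (n N : nat) (M : 'M[R]_n) : 'M[R]_N :=
  \matrix_(i < N, j < N)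
    if (insub (val i), insub (val j)) is (Some i', Some j') then M i' j'
    else (i == j)%:R.
Arguments stab {R n} N M.

Lemma stab_block (R : pzRingType) (n k : nat) (M : 'M[R]_n) :
  stab (n + k) M = block_mx M 0 0 1%:M.
Proof.
have insL m p (i : 'I_m) : insub (val (lshift p i)) = Some i by rewrite valK.
have insR m p (i : 'I_p) : insub (val (rshift m i)) = None :> option 'I_m.
  by rewrite insubF //= ltnNge leq_addr.
apply/matrixP=> i j; rewrite mxE.
case: (split_ordP i) => i' ->; case: (split_ordP j) => j' ->;
  rewrite ?insL ?insR ?block_mxEul ?block_mxEur ?block_mxEdl ?block_mxEdr ?mxE //.
- by rewrite eq_lrshift.
- by rewrite eq_rlshift.
- by rewrite eq_rshift.
Qed.

Section K1.
Variable R : nzRingType.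

Definition invertible (n : nat) (U : 'M[R]_n) : Prop :=
  exists2 V : 'M[R]_n, U *m V = 1%:M & V *m U = 1%:M.

(* Representatives of the elements of the direct limit of the GL_n(R); the    *)
(* identification of U with its stabilizations takes place in K1_class.       *)
Record GL : Type := MkGL {
  GL_size : nat;
  GL_mx :> 'M[R]_GL_size;
  GL_invertible : invertible GL_mx
}.

(* Closure under inverses is automatic: the inverse of 1 + r e_ij is          *)
(* 1 - r e_ij.                                                                *)
Inductive El (n : nat) : 'M[R]_n -> Prop :=
| El_one : El 1%:M
| El_mul (i j : 'I_n) (r : R) (E : 'M[R]_n) of i != j & El E :
    El ((1%:M + r *: delta_mx i j) *m E).

(* The coset U El(R).                                                         *)
Definition K1_class (U : GL) : set GL :=
  [set V : GL | exists (N : nat) (E : 'M[R]_N),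
    [/\ (GL_size U <= N)%N, (GL_size V <= N)%N, El E
      & stab N V = stab N U *m E]].

Definition K1 : set (set GL) := [set K1_class U | U in [set: GL]].

Fact invertible1 : invertible (1%:M : 'M[R]_0).
Proof. by exists 1%:M; rewrite mulmx1. Qed.

Definition K1_0 : set GL := K1_class (MkGL invertible1).

End K1.
Arguments K1 R : clear implicits.
Arguments K1_0 R : clear implicits.

Fact invertible_map (R S : nzRingType) (f : {rmorphism R -> S}) (n : nat)
  (U : 'M[R]_n) : invertible U -> invertible (map_mx f U).
Proof.
by case=> V UV VU; exists (map_mx f V); rewrite -map_mxM ?UV ?VU map_mx1.
Qed.

Definition GL_map (R S : nzRingType) (f : {rmorphism R -> S}) (U : GL R) : GL S :=
  MkGL (invertible_map f (GL_invertible U)).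

Definition K1_map (R S : nzRingType) (f : {rmorphism R -> S}) (c : set (GL R)) :
    set (GL S) :=
  \bigcup_(U in c) K1_class (GL_map f U).

(* coefp 0 is the ring morphism t |-> 0 from R[t] to R (horner_eval 0 is a    *)
(* ring morphism only for commutative R in the library).                      *)
Definition NK1 (R : nzRingType) : set (set (GL {poly R})) :=
  [set c | K1 {poly R} c /\ K1_map (coefp 0 : {rmorphism {poly R} -> R}) c = K1_0 R].

Arguments NK1 R : clear implicits.

(* I - tA *)
Definition I_sub_tmx (R : nzRingType) (n : nat) (A : 'M[R]_n) : 'M[{poly R}]_n :=
  1%:M - 'X *: map_mx polyC A.

(* An equality of infinite matrices is expressed at a finite stage N.         *)
Definition elementary_stabilizer (R : nzRingType) (n : nat) (A : 'M[R]_n) :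
    set (set (GL {poly R})) :=
  [set c | NK1 R c /\
    exists U : GL {poly R}, c = K1_class U /\
    exists (N : nat) (E : 'M[{poly R}]_N),
      [/\ (GL_size U <= N)%N, (n <= N)%N, El E
        & stab N U *m stab N (I_sub_tmx A) = stab N (I_sub_tmx A) *m E]].

(* Main.v *)
Require Import Defs.
From HB Require Import structures.
From mathcomp Require Import all_boot all_order all_algebra all_fingroup all_field.
From mathcomp Require Import classical_sets boolp zify.

Set Implicit Arguments.
Unset Strict Implicit.
Unset Printing Implicit Defensive.

Import Order.TTheory GRing.Theory Num.Theory.
Local Open Scope ring_scope.
Local Open Scope classical_set_scope.

(** Let R = ZG. Strong shift equivalence of A and B over R forces I - tA and
    I - tB to be El(R[t])-equivalent, so when E(A, R) is trivial, matrices B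
    with I - tB = V (I - tA') and A' strong shift equivalent to A are told apart
    by the class of V in NK_1(R).

    Infinitely many classes. Start from U with [U] <> 0. As NK_1(Z) = 0, one may
    divide U by its augmentation and assume that U augments to I. The transfer
    F_m along t |-> t^m satisfies F_m [U(t^m)] = m [U] and kills a given class for
    large m (write it as [I - tN] with N nilpotent); so finitely many classes
    [U(t^m)] would give m [U] = 0 for all large m, hence [U] = 0.

    Positivity. Let e be the sum of all g in G. Since U augments to I, (I - U) e = 0.
    Hence if A is strong shift equivalent over Z_+G to a polynomial presentation
    A(t) in which some rows are s(t) e, multiplying these rows of I - A(t) by
    U(t^m) only adds I - U(t^m) to one block of A(t), and the result is
    nonnegative as soon as s has large coefficients in the degrees m, 2m, ...
    Such rows are split off from a state whose first-return series has large
    multiples of e below every coefficient of high degree. To find such a state,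
    take a state whose first-return series is infinite, and put the new state on
    one very long first-return loop: removing that loop leaves all shorter loops.

    If V (I - tA) = I - tB with V invertible over R[t], then B A^q = A^(q+1) and
    A B^q = B^(q+1) for large q, so (A^q, B^q) is a shift equivalence, nonnegative
    with A and B. *)

(** * Elementary matrices and elementary equivalence *)

Section Elementary.
Variable R : nzRingType.

Lemma El_mulmx n (E F : 'M[R]_n) : El E -> El F -> El (E *m F).
Proof.
elim=> [|i j r E' ij _ IH] hF; first by rewrite mul1mx.
by rewrite -mulmxA; apply: El_mul => //; apply: IH.
Qed.

Lemma El_transvection n (i j : 'I_n) (r : R) : i != j -> El (1%:M + r *: delta_mx i j).
Proof. by move=> ij; rewrite -[_ + _]mulmx1; apply: El_mul => //; apply: El_one. Qed.

Lemma scale_delta_mul0 n (i j : 'I_n) (r s : R) : i != j ->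
  (r *: delta_mx i j) *m (s *: delta_mx i j) = 0 :> 'M[R]_n.
Proof.
move=> ij; apply/matrixP=> a b; rewrite !mxE big1 // => k _; rewrite !mxE.
by case: (k =P j) => [->|_]; rewrite ?(eq_sym j) ?(negPf ij) ?andbF /= ?mulr0 ?mul0r.
Qed.

Lemma El_inv n (E : 'M[R]_n) : El E ->
  exists F : 'M[R]_n, [/\ El F, E *m F = 1%:M & F *m E = 1%:M].
Proof.
elim=> [|i j r E' ij _ [F [hF EF FE]]].
  by exists 1%:M; rewrite mulmx1; split=> //; apply: El_one.
have h s : (1%:M + s *: delta_mx i j) *m (1%:M + (- s) *: delta_mx i j) = 1%:M :> 'M[R]_n.
  rewrite mulmxDl mul1mx mulmxDr mulmx1 scale_delta_mul0 // addr0.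
  by rewrite scaleNr subrK.
exists (F *m (1%:M + (- r) *: delta_mx i j)); split.
- by apply: El_mulmx => //; apply: El_transvection.
- by rewrite mulmxA -(mulmxA _ E') EF mulmx1 h.
- by rewrite mulmxA -(mulmxA F) -{2}(opprK r) h mulmx1.
Qed.

Lemma El_add n (Y Z : 'M[R]_n) :
  El (1%:M + Y) -> El (1%:M + Z) -> Y *m Z = 0 -> El (1%:M + (Y + Z)).
Proof.
move=> hY hZ YZ; have := El_mulmx hY hZ.
by rewrite mulmxDl mul1mx mulmxDr mulmx1 YZ addr0 -addrA (addrC Z).
Qed.

(** Products of two matrices with this support vanish, so [1 + Y] is the product of the
    transvections given by the entries of [Y]. *)
Lemma El_support n (P : pred 'I_n) (Y : 'M[R]_n) :
  (forall i j, Y i j != 0 -> P i && ~~ P j) -> El (1%:M + Y).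
Proof.
move=> hY; pose Q (Z : 'M[R]_n) := El (1%:M + Z) /\ forall i j, Z i j != 0 -> P i && ~~ P j.
suff: Q Y by case.
have Q0 : Q 0 by split=> [|i j]; rewrite ?addr0 ?mxE ?eqxx //; apply: El_one.
have QD Z1 Z2 : Q Z1 -> Q Z2 -> Q (Z1 + Z2).
  move=> [E1 h1] [E2 h2]; split.
    apply: El_add => //; apply/matrixP=> i j; rewrite !mxE big1 // => k _.
    case: (eqVneq (Z1 i k) 0) => [->|/h1 /andP[_ Pk]]; first by rewrite mul0r.
    case: (eqVneq (Z2 k j) 0) => [->|/h2 /andP[Pk' _]]; first by rewrite mulr0.
    by rewrite Pk' in Pk.
  move=> i j; rewrite mxE => h; case: (eqVneq (Z1 i j) 0) => [z|/h1 //].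
  by apply: h2; rewrite z add0r in h.
rewrite [Y]matrix_sum_delta; apply: (big_ind Q) => // i _; apply: (big_ind Q) => // j _.
case: (eqVneq (Y i j) 0) => [->|/hY /andP[Pi Pj]]; first by rewrite scale0r.
split=> [|a b]; first by apply: El_transvection; apply: contraNneq Pj => <-.
rewrite !mxE; case: (a =P i) => [->|_]; last by rewrite mulr0 eqxx.
by case: (b =P j) => [->|_]; rewrite ?Pi ?Pj // mulr0 eqxx.
Qed.

(** Such a [Y] is strictly triangular for the levels of [d]. [Yc c] keeps the rows of level at least
    [c]; when the rows [L] of level [c] are split off, [Yc c.+1 *m L = 0], because [Yc c.+1] only
    leads to levels above [c]. *)
Lemma El_graded n (d : 'I_n -> nat) (Y : 'M[R]_n) :
  (forall i j, Y i j != 0 -> (d i < d j)%N) -> El (1%:M + Y).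
Proof.
move=> hY; pose Yc c : 'M[R]_n := \matrix_(i, j) (if (c <= d i)%N then Y i j else 0).
have -> : Y = Yc 0%N by apply/matrixP=> i j; rewrite mxE.
pose m := (\max_i d i).+1; have -> : 0%N = (m - m)%N by rewrite subnn.
have: (m <= m)%N by []; elim: {1 4}m => [|k IH] km.
  rewrite subn0 (_ : Yc m = 0) ?addr0; first exact: El_one.
  apply/matrixP=> i j; rewrite !mxE ifN // -ltnNge ltnS.
  exact: (leq_bigmax i).
set c := (m - k.+1)%N; have ec : (m - k)%N = c.+1 by rewrite /c subnSK.
pose L : 'M[R]_n := \matrix_(i, j) (if d i == c then Y i j else 0).
have -> : Yc c = Yc c.+1 + L.
  apply/matrixP=> i j; rewrite !mxE [(c <= _)%N]leq_eqVlt eq_sym.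
  by case: eqP => [->|_] /=; rewrite ?ltnn ?add0r ?addr0.
apply: El_add.
- by rewrite -ec; apply: IH; apply: ltnW.
- apply: (El_support (P := fun i => d i == c)) => i j; rewrite mxE.
  case: (d i =P c) => [e|_]; last by rewrite eqxx.
  by move=> /hY; rewrite e /=; case: ltngtP.
- apply/matrixP=> i j; rewrite !mxE big1 // => k' _; rewrite !mxE.
  case: ifP => [ci|_]; last by rewrite mul0r.
  case: (d k' =P c) => [ek|_]; last by rewrite mulr0.
  case: (eqVneq (Y i k') 0) => [->|/hY]; first by rewrite mul0r.
  by rewrite ek ltnNge (ltnW ci).
Qed.

Lemma stab_mul n N (A B : 'M[R]_n) : (n <= N)%N ->
  stab N (A *m B) = stab N A *m stab N B.
Proof.
move=> nN; rewrite -(subnKC nN) !stab_block mulmx_block.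
by rewrite !mulmx0 !mul0mx !addr0 add0r mulmx1.
Qed.

Lemma stab1 n N : (n <= N)%N -> stab N (1%:M : 'M[R]_n) = 1%:M.
Proof. by move=> nN; rewrite -(subnKC nN) !stab_block -scalar_mx_block. Qed.

Lemma stab_id n (A : 'M[R]_n) : stab n A = A.
Proof. by apply/matrixP=> i j; rewrite mxE !valK. Qed.

Lemma stab_stab n m N (A : 'M[R]_n) : (n <= m)%N -> (m <= N)%N ->
  stab N (stab m A) = stab N A.
Proof.
move=> nm mN; apply/matrixP=> i j; rewrite !mxE.
have insN p (x : nat) : (p <= x)%N -> insub x = None :> option 'I_p.
  by move=> px; rewrite insubF //= ltnNge px.
have [im|im] := ltnP (val i) m; last first.
  by rewrite !insN // (leq_trans nm im).
rewrite (insubT (fun k => k < m)%N im) /=.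
have [jm|jm] := ltnP (val j) m; last first.
  rewrite (insN m) //.
  by case: insubP => // ? _ _; rewrite insN // (leq_trans nm jm).
by rewrite (insubT (fun k => k < m)%N jm) /= mxE.
Qed.

Lemma stab_El n N (E : 'M[R]_n) : (n <= N)%N -> El E -> El (stab N E).
Proof.
move=> nN; elim=> [|i j r E' ij _ IH]; first by rewrite stab1 //; apply: El_one.
rewrite stab_mul //; apply: El_mulmx => //.
have ->: stab N (1%:M + r *: delta_mx i j) =
    1%:M + r *: delta_mx (widen_ord nN i) (widen_ord nN j).
  apply/matrixP=> a b; rewrite !mxE.
  case: insubP => [a' _ ea|na]; last first.
    rewrite (_ : a == widen_ord _ _ = false) ?mulr0 ?addr0 //.
    by apply/eqP=> e; rewrite e /= ltn_ord in na.
  case: insubP => [b' _ eb|nb]; last first.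
    rewrite (_ : b == widen_ord _ _ = false) ?andbF ?mulr0 ?addr0 //.
    by apply/eqP=> e; rewrite e /= ltn_ord in nb.
  by rewrite !mxE -!val_eqE /= -ea -eb !val_eqE.
by apply: El_transvection; rewrite -val_eqE /= val_eqE.
Qed.

Lemma El_block_upper m n (X : 'M[R]_(m, n)) : El (block_mx 1%:M X 0 1%:M).
Proof.
have -> : block_mx 1%:M X 0 1%:M = 1%:M + block_mx 0 X 0 0 :> 'M[R]_(m + n).
  by rewrite (scalar_mx_block m n 1) add_block_mx !addr0 add0r.
apply: (El_support (P := fun i => (i < m)%N)) => i j.
case: (split_ordP i) => i' ->; case: (split_ordP j) => j' ->;
  by rewrite ?block_mxEul ?block_mxEur ?block_mxEdl ?block_mxEdr ?mxE ?eqxx //=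
    ltn_ord -leqNgt leq_addr.
Qed.

Lemma El_block_lower m n (X : 'M[R]_(n, m)) : El (block_mx 1%:M 0 X 1%:M).
Proof.
have -> : block_mx 1%:M 0 X 1%:M = 1%:M + block_mx 0 0 X 0 :> 'M[R]_(m + n).
  by rewrite (scalar_mx_block m n 1) add_block_mx !addr0 add0r.
apply: (El_support (P := fun i => (m <= i)%N)) => i j.
case: (split_ordP i) => i' ->; case: (split_ordP j) => j' ->;
  by rewrite ?block_mxEul ?block_mxEur ?block_mxEdl ?block_mxEdr ?mxE ?eqxx //=
    leq_addr -ltnNge ltn_ord.
Qed.

End Elementary.

Lemma map_stab (R S : nzRingType) (f : {rmorphism R -> S}) n N (A : 'M[R]_n) :
  map_mx f (stab N A) = stab N (map_mx f A).
Proof.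
apply/matrixP=> i j; rewrite !mxE; case: insubP => [? _ _|_]; last by rewrite rmorph_nat.
by case: insubP => [? _ _|_]; rewrite ?rmorph_nat ?mxE.
Qed.

Lemma map_El (R S : nzRingType) (f : {rmorphism R -> S}) n (E : 'M[R]_n) :
  El E -> El (map_mx f E).
Proof.
elim=> [|i j r E' ij _ IH]; first by rewrite map_mx1; apply: El_one.
rewrite map_mxM map_mxD map_mx1 map_mxZ map_delta_mx.
exact: El_mul.
Qed.

Section ElementaryEquivalence.
Variable R : nzRingType.

(** A relation at stage [N] persists at all later stages, so this is El(R)-equivalence of the
    infinite stabilizations. It is meant for matrices such as I - tA, of any two sizes and possibly
    not invertible. *)
Definition El_equiv m n (A : 'M[R]_m) (B : 'M[R]_n) : Prop :=
  exists (N : nat) (E F : 'M[R]_N),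
    [/\ (m <= N)%N, (n <= N)%N, El E, El F & stab N A = E *m stab N B *m F].

Definition stably_El n (A : 'M[R]_n) : Prop :=
  exists2 N : nat, (n <= N)%N & El (stab N A).

Lemma El_equiv_at m n (A : 'M[R]_m) (B : 'M[R]_n) : El_equiv A B ->
  exists N0, forall N, (N0 <= N)%N ->
    [/\ (m <= N)%N, (n <= N)%N & exists E F : 'M[R]_N,
      [/\ El E, El F & stab N A = E *m stab N B *m F]].
Proof.
case=> N [E [F [mN nN hE hF e]]]; exists N => N' NN'; split; try exact: leq_trans NN'.
exists (stab N' E), (stab N' F); split; try exact: stab_El.
by rewrite -(stab_stab A mN NN') e !stab_mul // stab_stab.
Qed.

Lemma El_equiv_mul n (E A F : 'M[R]_n) : El E -> El F -> El_equiv (E *m A *m F) A.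
Proof. by move=> hE hF; exists n, E, F; split; rewrite // !stab_id. Qed.

Lemma El_equiv_stab n N (A : 'M[R]_n) : (n <= N)%N -> El_equiv (stab N A) A.
Proof.
by move=> nN; exists N, 1%:M, 1%:M; split; rewrite ?mulmx1 ?mul1mx ?stab_id //; apply: El_one.
Qed.

Lemma El_equiv_sym m n (A : 'M[R]_m) (B : 'M[R]_n) : El_equiv A B -> El_equiv B A.
Proof.
case=> N [E [F [mN nN hE hF e]]].
have [E' [hE' EE' E'E]] := El_inv hE; have [F' [hF' FF' F'F]] := El_inv hF.
exists N, E', F'; split => //.
by rewrite e -!mulmxA FF' mulmx1 mulmxA E'E mul1mx.
Qed.

Lemma El_equiv_trans m n p (A : 'M[R]_m) (B : 'M[R]_n) (C : 'M[R]_p) :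
  El_equiv A B -> El_equiv B C -> El_equiv A C.
Proof.
move=> /El_equiv_at[N1 h1] /El_equiv_at[N2 h2]; pose N := maxn N1 N2.
have [mN nN [E1 [F1 [hE1 hF1 e1]]]] := h1 N (leq_maxl _ _).
have [_ pN [E2 [F2 [hE2 hF2 e2]]]] := h2 N (leq_maxr _ _).
exists N, (E1 *m E2), (F2 *m F1); split=> //; try exact: El_mulmx.
by rewrite e1 e2 !mulmxA.
Qed.

Lemma stably_El_equiv m n (A : 'M[R]_m) (B : 'M[R]_n) :
  El_equiv A B -> stably_El B -> stably_El A.
Proof.
move=> /El_equiv_at[N1 h1] [N2 nN2 h2]; pose N := maxn N1 N2.
have [mN nN [E1 [F1 [hE1 hF1 e1]]]] := h1 N (leq_maxl _ _).
exists N => //; rewrite e1; do 2![apply: El_mulmx => //].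
by rewrite -(stab_stab B nN2) ?leq_maxr //; apply: stab_El => //; apply: leq_maxr.
Qed.

Lemma stably_El_mulmx n (A B : 'M[R]_n) :
  stably_El A -> stably_El B -> stably_El (A *m B).
Proof.
move=> [N1 nN1 h1] [N2 nN2 h2]; exists (maxn N1 N2); first by rewrite leq_max nN1.
rewrite stab_mul ?leq_max ?nN1 //; apply: El_mulmx.
  by rewrite -(stab_stab A nN1) ?leq_maxl //; apply: stab_El; rewrite ?leq_maxl.
by rewrite -(stab_stab B nN2) ?leq_maxr //; apply: stab_El; rewrite ?leq_maxr.
Qed.

Lemma El_stably_El n (A : 'M[R]_n) : El A -> stably_El A.
Proof. by exists n; rewrite ?stab_id. Qed.

Lemma stably_El_inv n (A B : 'M[R]_n) : A *m B = 1%:M -> stably_El A -> stably_El B.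
Proof.
move=> AB [N nN h]; exists N => //; have [F [hF EF FE]] := El_inv h.
by rewrite -[stab N B]mul1mx -FE -mulmxA -stab_mul // AB stab1 // mulmx1.
Qed.

Lemma stably_El_cancel n (A B : 'M[R]_n) :
  stably_El (A *m B) -> stably_El B -> stably_El A.
Proof.
move=> [N1 nN1 h1] [N2 nN2 h2]; pose N := maxn N1 N2.
have nN : (n <= N)%N by rewrite leq_max nN1.
have hB : El (stab N B).
  by rewrite -(stab_stab B nN2) ?leq_maxr //; apply: stab_El; rewrite ?leq_maxr.
have hAB : El (stab N (A *m B)).
  by rewrite -(stab_stab _ nN1) ?leq_maxl //; apply: stab_El; rewrite ?leq_maxl.
exists N => //; have [F [hF BF FB]] := El_inv hB.
by rewrite -[stab N A]mulmx1 -BF mulmxA -stab_mul //; apply: El_mulmx.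
Qed.

(* Whitehead's lemma: [[0, P], [-Q, 0]] is a product of unitriangular blocks. *)
Lemma El_swap n (P Q : 'M[R]_n) : P *m Q = 1%:M -> Q *m P = 1%:M ->
  El (block_mx 0 P (- Q) 0).
Proof.
move=> PQ QP; have -> : block_mx 0 P (- Q) 0 =
   block_mx 1%:M P 0 1%:M *m block_mx 1%:M 0 (- Q) 1%:M *m block_mx 1%:M P 0 1%:M.
  rewrite !mulmx_block !mulmx0 !mul0mx !mulmx1 !mul1mx !mulmxN PQ.
  by rewrite !(addr0, add0r) subrr mul0mx add0r mulNmx QP addNr.
apply: El_mulmx; last exact: El_block_upper.
by apply: El_mulmx; [exact: El_block_upper|exact: El_block_lower].
Qed.

(** [[[0, P], [-Q, 0]] diag(1, A) [[0, -P], [Q, 0]] = diag(P A Q, 1)], and the outer factors are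
    elementary. *)
Lemma El_equiv_conj_block n (P Q A : 'M[R]_n) : P *m Q = 1%:M -> Q *m P = 1%:M ->
  El_equiv (block_mx (P *m A *m Q) 0 0 (1%:M : 'M_n)) (block_mx (1%:M : 'M_n) 0 0 A).
Proof.
move=> PQ QP; have NPQ : (- P) *m (- Q) = 1%:M by rewrite mulNmx mulmxN opprK.
have NQP : (- Q) *m (- P) = 1%:M by rewrite mulNmx mulmxN opprK.
exists (n + n)%N, (block_mx 0 P (- Q) 0), (block_mx 0 (- P) (- - Q) 0).
split=> //; try exact: El_swap.
rewrite !stab_id !mulmx_block !(mulmx0, mul0mx, addr0, add0r, mulmx1, mul1mx) opprK.
by rewrite NQP.
Qed.

Lemma El_equiv_stab_block n k (A : 'M[R]_n) :
  El_equiv (block_mx A 0 0 (1%:M : 'M_k)) A.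
Proof. by rewrite -stab_block; apply: El_equiv_stab; apply: leq_addr. Qed.

(** After doubling the size, the block swap is used twice: with [P], and with the identity to bring
    [A] back to the first block. The sizes are linked by an equation because they will be [m + n]
    and [n + m], or [#|'I_n|] and [n]. *)
Lemma El_equiv_conj p q (P : 'M[R]_(p, q)) (Q : 'M[R]_(q, p)) (A : 'M[R]_q) :
  p = q -> P *m Q = 1%:M -> Q *m P = 1%:M -> El_equiv (P *m A *m Q) A.
Proof.
move=> e; case: _ / e P Q A => P Q A PQ QP.
apply: El_equiv_trans (El_equiv_sym (El_equiv_stab_block p _)) _.
apply: El_equiv_trans (El_equiv_conj_block A PQ QP) _.
apply: El_equiv_trans (El_equiv_stab_block p _).
apply: El_equiv_sym.
by have := @El_equiv_conj_block p 1%:M 1%:M A; rewrite !mul1mx mulmx1; apply.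
Qed.

Lemma El_equiv_block1 m n (A : 'M[R]_n) :
  El_equiv (block_mx (1%:M : 'M_m) 0 0 A) A.
Proof.
apply: El_equiv_trans (El_equiv_stab_block m A).
pose P : 'M[R]_(m + n, n + m) := block_mx 0 1%:M 1%:M 0.
pose Q : 'M[R]_(n + m, m + n) := block_mx 0 1%:M 1%:M 0.
have -> : block_mx 1%:M 0 0 A = P *m block_mx A 0 0 1%:M *m Q.
  by rewrite !mulmx_block !(mulmx0, mul0mx, addr0, add0r, mulmx1, mul1mx).
apply: El_equiv_conj; rewrite ?[(m + n)%N]addnC // mulmx_block;
  by rewrite !(mulmx0, mul0mx, addr0, add0r, mulmx1, mul1mx) -scalar_mx_block.
Qed.

(** Both sides are Schur complements of [[[1, U], [V, 1]]]: clearing either diagonal block by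
    unitriangular factors leaves one of them next to an identity. *)
Lemma El_equiv_1subM m n (U : 'M[R]_(m, n)) (V : 'M[R]_(n, m)) :
  El_equiv (1%:M - U *m V) (1%:M - V *m U).
Proof.
apply: El_equiv_trans (El_equiv_sym (El_equiv_stab_block n _)) _.
apply: El_equiv_trans (El_equiv_block1 m _).
exists (m + n)%N, (block_mx 1%:M (- U) 0 1%:M *m block_mx 1%:M 0 V 1%:M),
  (block_mx 1%:M U 0 1%:M *m block_mx 1%:M 0 (- V) 1%:M); split=> //.
- by apply: El_mulmx; [exact: El_block_upper|exact: El_block_lower].
- by apply: El_mulmx; [exact: El_block_upper|exact: El_block_lower].
rewrite !stab_id !mulmx_block !(mulmx0, mul0mx, addr0, add0r, mulmx1, mul1mx).
rewrite !(mulmxN, mulNmx, mulmxBl, mulmxBr, mulmxDl, mulmxDr, mul1mx, mulmx1).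
congr block_mx; rewrite ?mulmxA ?subrr ?opprK //.
- rewrite -[RHS]addrA -[LHS]addr0; congr (_ + _).
  by rewrite addrACA addNr subrr addr0.
- by rewrite addrC subrK.
Qed.

End ElementaryEquivalence.

(** * Strong shift equivalence and nilpotency in terms of I - tA *)

Section PolynomialMatrices.
Variable R : nzRingType.

Lemma mulmx_scaleX m n p (M : 'M[{poly R}]_(m, n)) (N : 'M[{poly R}]_(n, p)) :
  M *m ('X *: N) = 'X *: (M *m N).
Proof.
apply/matrixP=> i j; rewrite !mxE mulr_sumr; apply: eq_bigr => k _.
by rewrite !mxE mulrA (commr_polyX (M i k)) mulrA.
Qed.

Lemma ESSE_El_equiv m n (A : 'M[R]_m) (B : 'M[R]_n) :
  ESSE A B -> El_equiv (I_sub_tmx A) (I_sub_tmx B).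
Proof.
case=> U [V [-> ->]]; rewrite /I_sub_tmx !map_mxM /= scalemxAl -mulmx_scaleX.
exact: El_equiv_1subM.
Qed.

Lemma SSE_El_equiv m n (A : 'M[R]_m) (B : 'M[R]_n) :
  SSE A B -> El_equiv (I_sub_tmx A) (I_sub_tmx B).
Proof.
elim=> {m n A B} [m n A B /ESSE_El_equiv //|m n A B p C _ h1 _ h2].
exact: El_equiv_trans h1 h2.
Qed.

(* Comparing coefficients: [V = (1 - tB)(1 + tA + t^2 A^2 + ...)]. *)
Lemma I_sub_tmx_intertwine n (A B : 'M[R]_n) (V : 'M[{poly R}]_n) :
  V *m I_sub_tmx A = I_sub_tmx B ->
  exists q0, forall q, (q0 <= q)%N -> B *m (A ^+ q) = A ^+ q.+1.
Proof.
move=> e; pose W i : 'M[R]_n := map_mx (coefp i) V.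
have cX i (M : 'M[{poly R}]_n) :
    map_mx (coefp i) ('X *: M) = (if i is j.+1 then map_mx (coefp j) M else 0).
  by apply/matrixP=> a b; case: i => [|i]; rewrite !mxE /= coefXM.
have cM i (M : 'M[{poly R}]_n) (C : 'M[R]_n) :
    map_mx (coefp i) (M *m map_mx polyC C) = map_mx (coefp i) M *m C.
  apply/matrixP=> a b; rewrite !mxE /= coef_sum; apply: eq_bigr => k _.
  by rewrite !mxE /= coefMC.
have c1 i : map_mx (coefp i) (1%:M : 'M[{poly R}]_n) = (if i is 0 then 1%:M else 0).
  apply/matrixP=> a b; rewrite !mxE /= -polyC_natr coefC.
  by case: i => [|i]; rewrite /= !mxE.
have cB i M N : map_mx (coefp i) (M - N) =
    map_mx (coefp i) M - map_mx (coefp i) N :> 'M[R]_n.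
  by apply/matrixP=> a b; rewrite !mxE /= coefB.
have W0 : W 0%N = 1%:M.
  have := congr1 (map_mx (coefp 0%N)) e.
  by rewrite /I_sub_tmx mulmxBr mulmx1 mulmx_scaleX !cB !cX c1 !subr0.
have WS i : W i.+1 = W i *m A - (if i is 0 then B else 0).
  have := congr1 (map_mx (coefp i.+1)) e.
  rewrite /I_sub_tmx mulmxBr mulmx1 mulmx_scaleX !cB !cX c1 cM.
  rewrite -[map_mx polyC B]mul1mx cM c1 -/(W i) -/(W i.+1) sub0r => /eqP.
  rewrite subr_eq => /eqP ->; rewrite addrC; congr (_ - _).
  by case: i => [|i]; rewrite ?mul1mx ?mul0mx.
(* [E] lists the coefficients of (1 - tB)^-1 V, which is (1 - tA)^-1, whence [E i = A ^+ i]. Beyond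
   the degree of V the recursion reads [E q.+1 = B *m E q]. *)
pose E := fix E i := if i is j.+1 then B *m E j + W j.+1 else W 0%N.
have EA i : E i.+1 = E i *m A.
  elim: i => [|i IH]; first by rewrite /= WS W0 mulmx1 mul1mx addrC subrK.
  by rewrite [E i.+2]/= -/(E i.+1) WS subr0 [in RHS]/= mulmxDl -mulmxA -IH.
have Epow i : E i = A ^+ i.
  by elim: i => [|i IH]; [exact: W0 | rewrite EA exprSr IH].
pose q0 := (\max_i \max_j size (V i j))%N.
exists q0 => q qq; rewrite -!Epow [E q.+1]/= (_ : W q.+1 = 0) ?addr0 //.
apply/matrixP=> i j; rewrite !mxE /= nth_default //.
apply: leq_trans (leqW qq).
by apply: leq_trans (leq_bigmax i); apply: (leq_bigmax j).
Qed.

Lemma I_sub_tmx_nilpotent n (N : 'M[R]_n) (V : 'M[{poly R}]_n) :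
  V *m I_sub_tmx N = 1%:M -> exists q0, forall q, (q0 <= q)%N -> N ^+ q = 0.
Proof.
move=> e; have e0 : V *m I_sub_tmx N = I_sub_tmx 0.
  by rewrite e /I_sub_tmx map_mx0 scaler0 subr0.
have [q0 h] := I_sub_tmx_intertwine e0; exists q0.+1 => -[|q] // qq.
by rewrite -h // mul0mx.
Qed.

End PolynomialMatrices.

(** * Matrices indexed by finite types *)

Definition mxf (R : Type) (T T' : finType) (f : T -> T' -> R) : 'M[R]_(#|T|, #|T'|) :=
  \matrix_(i, j) f (enum_val i) (enum_val j).

Lemma eq_mxf (R : Type) (T T' : finType) (f g : T -> T' -> R) : f =2 g -> mxf f = mxf g.
Proof. by move=> fg; apply/matrixP=> i j; rewrite !mxE fg. Qed.

Lemma mxf_rank (R : Type) (T T' : finType) (f : T -> T' -> R) a b :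
  mxf f (enum_rank a) (enum_rank b) = f a b.
Proof. by rewrite mxE !enum_rankK. Qed.

Lemma sum_enum_val (R : nmodType) (T : finType) (F : T -> R) :
  \sum_(i < #|T|) F (enum_val i) = \sum_a F a.
Proof. by rewrite [RHS](reindex (@enum_val T predT)) //; apply: onW_bij; apply: enum_val_bij. Qed.

Lemma mxf_mul (R : pzSemiRingType) (T T' T'' : finType) (f : T -> T' -> R) (g : T' -> T'' -> R) :
  mxf f *m mxf g = mxf (fun a c => \sum_b f a b * g b c).
Proof.
apply/matrixP=> i j; rewrite !mxE -[RHS]sum_enum_val.
by apply: eq_bigr => k _; rewrite !mxE.
Qed.

Lemma mxf1 (R : pzSemiRingType) (T : finType) :
  1%:M = mxf (fun a b : T => (a == b)%:R) :> 'M[R]_#|T|.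
Proof. by apply/matrixP=> i j; rewrite !mxE (inj_eq enum_val_inj). Qed.

Lemma map_mxf (R S : Type) (h : R -> S) (T T' : finType) (f : T -> T' -> R) :
  map_mx h (mxf f) = mxf (fun a b => h (f a b)).
Proof. by apply/matrixP=> i j; rewrite !mxE. Qed.

Lemma big_delta (R : pzSemiRingType) (T : finType) (a : T) (F : T -> R) :
  \sum_b (b == a)%:R * F b = F a.
Proof.
rewrite (bigD1 a) //= eqxx mul1r big1 ?addr0 // => b /negPf->.
by rewrite mul0r.
Qed.

(** * Higman linearization *)

(* A polynomial matrix [1 - sum_l t^(l+1) c_l] is turned into a linear one on   *)
(* chains of states [pos i 0 -> pos i 1 -> ...]. The rows of [M] on the chains  *)
(* may have further entries [X], provided that [u] annihilates them.            *)
Section ChainTwist.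
Variables (R : nzRingType) (W : finType) (k D : nat).
Variable pos : 'I_k -> 'I_D.+1 -> W.
Variable c : 'I_D.+1 -> 'I_k -> 'I_k -> R.
Variable u : W -> 'I_k -> R.
Hypothesis upos : forall i l j, u (pos i l) j = c l i j.

Definition chain_poly : 'M[{poly R}]_k :=
  1%:M - \matrix_(i, j) \sum_(l < D.+1) 'X^(l.+1) * (c l i j)%:P.

Definition chain_in : 'M[{poly R}]_(#|W|, k) :=
  \matrix_(w, j) (u (enum_val w) j)%:P.

Definition chain_out : 'M[{poly R}]_(k, #|W|) :=
  \matrix_(i, w) \sum_(l < D.+1) (enum_val w == pos i l)%:R * 'X^(l.+1).

Definition chain_twist : 'M[{poly R}]_#|W| := 1%:M - chain_in *m chain_out.

Lemma chain_polyE : chain_poly = 1%:M - chain_out *m chain_in.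
Proof.
congr (_ - _); apply/matrixP=> i j; rewrite !mxE.
under [RHS]eq_bigr => w _ do rewrite !mxE mulr_suml.
rewrite exchange_big; apply: eq_bigr => l _ /=.
rewrite (sum_enum_val (fun w => (w == pos i l)%:R * 'X^(l.+1) * (u w j)%:P)).
under eq_bigr => w _ do rewrite -mulrA.
by rewrite (big_delta _ (fun w => 'X^(l.+1) * (u w j)%:P)) upos.
Qed.

Lemma chain_twist_equiv : El_equiv chain_twist chain_poly.
Proof. by rewrite chain_polyE; apply: El_equiv_1subM. Qed.

(** If Y inverts 1 - QP, then 1 + PYQ inverts 1 - PQ; here P is [chain_in] and Q is [chain_out]. *)
Lemma chain_twist_invertible : invertible chain_poly -> invertible chain_twist.
Proof.
have e : chain_out *m chain_in = 1%:M - chain_poly by rewrite chain_polyE subKr.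
case=> Y UY YU; exists (1%:M + chain_in *m Y *m chain_out); rewrite /chain_twist.
  rewrite mulmxDr mulmx1 mulmxBl mul1mx.
  have -> : chain_in *m chain_out *m (chain_in *m Y *m chain_out) =
      chain_in *m Y *m chain_out - chain_in *m chain_out.
    by rewrite -!mulmxA (mulmxA chain_out) e mulmxBl mul1mx mulmxBr (mulmxA chain_poly) UY mul1mx.
  by rewrite subKr subrK.
rewrite mulmxDl mul1mx mulmxBr mulmx1.
have -> : chain_in *m Y *m chain_out *m (chain_in *m chain_out) =
    chain_in *m Y *m chain_out - chain_in *m chain_out.
  by rewrite -!mulmxA (mulmxA chain_out) e mulmxBl mul1mx !mulmxBr (mulmxA Y) YU mul1mx.
by rewrite subKr subrK.
Qed.

Variable M : W -> W -> R.
Variable X : 'I_k -> 'I_D.+1 -> W -> R.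
Hypothesis Mpos : forall i l w,
  M (pos i l) w = \sum_(l' < D.+1 | l' == l.+1 :> nat) (w == pos i l')%:R + X i l w.
Hypothesis uX : forall w l w', \sum_j u w j * X j l w' = 0.

Definition chain_add (w w' : W) : R := M w w' + \sum_j u w j * (w' == pos j ord0)%:R.

(** The sum telescopes along each chain: t^(l+1) at [pos i l], moved by tM, cancels t^(l+2) at the
    next position. Only the start of the chain and the entries [X] survive. *)
Lemma chain_out_I_sub i w : (chain_out *m I_sub_tmx (mxf M)) i (enum_rank w) =
  (w == pos i ord0)%:R * 'X - \sum_(l < D.+1) 'X^(l.+2) * (X i l w)%:P.
Proof.
rewrite /I_sub_tmx mulmxBr mulmx1 mulmx_scaleX !mxE enum_rankK.
under [X in 'X * X]eq_bigr => v _ do rewrite !mxE enum_rankK mulr_suml.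
rewrite exchange_big /=.
under [X in 'X * X]eq_bigr => l _.
  rewrite (sum_enum_val (fun v => (v == pos i l)%:R * 'X^(l.+1) * (M v w)%:P)).
  under eq_bigr => v _ do rewrite -mulrA.
  rewrite (big_delta _ (fun v => 'X^(l.+1) * (M v w)%:P)) Mpos polyCD mulrDr.
over.
rewrite big_split mulrDr opprD addrA; congr (_ - _); last first.
  by rewrite mulr_sumr; apply: eq_bigr => l _; rewrite mulrA -exprS.
have -> : \sum_(l < D.+1) 'X^(l.+1) *
      (\sum_(l' < D.+1 | l' == l.+1 :> nat) (w == pos i l')%:R)%:P =
    \sum_(l < D) (w == pos i (lift ord0 l))%:R * 'X^(l.+1) :> {poly R}.
  under eq_bigr => l _ do rewrite rmorph_sum mulr_sumr.
  rewrite (exchange_big_dep xpredT) //= big_ord_recl big_pred0 // add0r.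
  apply: eq_bigr => l _.
  rewrite (big_pred1 (widen_ord (leqnSn D) l)) => [|l' /=]; last first.
    by rewrite -val_eqE /= eqSS eq_sym.
  by rewrite rmorph_nat mulr_natl mulr_natr.
rewrite big_ord_recl expr1 -[RHS]addr0 -addrA; congr (_ + _); apply/eqP.
rewrite subr_eq0 mulr_sumr; apply/eqP; apply: eq_bigr => l _.
by rewrite mulr_natl mulr_natl mulrnAr -exprS.
Qed.

(** Since [u] annihilates [X], what survives the telescoping is t at the starts of the chains. The
    twist therefore only adds edges of weight [u w j] from [w] to the start of chain [j]. *)
Lemma chain_twistM :
  chain_twist *m I_sub_tmx (mxf M) = I_sub_tmx (mxf chain_add).
Proof.
rewrite /chain_twist mulmxBl mul1mx -mulmxA.
have -> : chain_in *m (chain_out *m I_sub_tmx (mxf M)) =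
    'X *: map_mx polyC (mxf (fun w w' => \sum_j u w j * (w' == pos j ord0)%:R)).
  apply/matrixP=> a b; rewrite !mxE rmorph_sum mulr_sumr.
  rewrite -(enum_valK b); set w' := enum_val b.
  under eq_bigr => j _ do rewrite chain_out_I_sub !mxE mulrBr mulr_sumr.
  rewrite sumrB [X in _ - X](_ : _ = 0) ?subr0.
    apply: eq_bigr => j _; rewrite enum_rankK rmorphM rmorph_nat /=.
    by rewrite -[RHS]commr_polyX mulrA.
  rewrite exchange_big big1 //= => l _.
  under eq_bigr => j _ do rewrite mulrA (commr_polyXn _ _) -mulrA -polyCM.
  by rewrite -mulr_sumr -rmorph_sum uX rmorph0 mulr0.
apply/matrixP=> a b; rewrite !mxE rmorphD mulrDr opprD addrA.
by [].
Qed.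
End ChainTwist.

Section Higman.
Variable R : nzRingType.

(** Position [l] of a chain carries the coefficient of t^(l+1), so chains with [D.+1] positions
    serve degrees up to [D.+1], that is, sizes up to [D.+2]. *)
Lemma chain_poly_coef k D (U : 'M[{poly R}]_k) :
  map_mx (coefp 0) U = 1%:M -> (forall i j, (size (U i j) <= D.+2)%N) ->
  chain_poly (fun (l : 'I_D.+1) i j => - (U i j)`_l.+1) = U.
Proof.
move=> U0 sU; apply/matrixP=> i j; rewrite !mxE.
have := congr1 (fun A : 'M_k => A i j) U0; rewrite !mxE /= => e.
apply/polyP=> m; rewrite coefB coef_sum -polyC_natr coefC.
under eq_bigr => l _ do rewrite coefMC coefXn mulrN.
rewrite sumrN opprK; case: m => [|m] /=.
  by rewrite e big1 ?addr0 // => l _; rewrite mul0r.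
rewrite add0r; have [mD|Dm] := ltnP m D.+1; last first.
  rewrite nth_default ?(leq_trans (sU i j)) // big1 // => l _.
  by rewrite eqSS gtn_eqF ?mul0r // (leq_trans (ltn_ord l)).
rewrite (bigD1 (Ordinal mD)) //= eqxx mul1r big1 ?addr0 // => l /negPf hl.
by rewrite eqSS eq_sym -[m]/(val (Ordinal mD)) val_eqE hl mul0r.
Qed.

Lemma poly_mx_size_bound k (U : 'M[{poly R}]_k) :
  exists D0, forall i j, (size (U i j) <= D0)%N.
Proof.
exists (\max_i \max_j size (U i j))%N => i j.
by apply: leq_trans (leq_bigmax i); apply: (leq_bigmax j).
Qed.

(** Apply the twist to bare chains, with [X] zero. Their I - tM is unitriangular for the position in
    the chain, hence elementary, so the product I - tN is equivalent to the twist and thus to [U].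
    Being invertible over R[t], it forces [N] to be nilpotent. *)
Lemma Higman_linearization k (U : 'M[{poly R}]_k) :
  map_mx (coefp 0) U = 1%:M -> invertible U ->
  exists n (N : 'M[R]_n) q, El_equiv U (I_sub_tmx N) /\ N ^+ q = 0.
Proof.
move=> U0 Uinv; have [D0 hD0] := poly_mx_size_bound U.
have sU i j : (size (U i j) <= D0.+2)%N by apply: leq_trans (hD0 i j) _; rewrite ltnW.
pose c (l : 'I_D0.+1) i j := - (U i j)`_l.+1.
pose W : finType := ('I_k * 'I_D0.+1)%type.
pose pos (i : 'I_k) (l : 'I_D0.+1) : W := (i, l).
pose u (w : W) j := c w.2 w.1 j.
pose M (w w' : W) : R := \sum_(l' < D0.+1 | l' == w.2.+1 :> nat) (w' == pos w.1 l')%:R.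
have hM : El (I_sub_tmx (mxf M)).
  rewrite /I_sub_tmx; apply: (El_graded (d := fun a => (enum_val a : W).2)) => a b.
  rewrite !mxE; apply: contraNT; rewrite -leqNgt => ba.
  rewrite /M big1 ?polyC0 ?mulr0 ?oppr0 // => l' /eqP hl.
  case: eqP => // e; move: ba; rewrite e /= hl ltnn //.
have upos i l j : u (pos i l) j = c l i j by [].
have Mpos i l w : M (pos i l) w =
    \sum_(l' < D0.+1 | l' == l.+1 :> nat) (w == pos i l')%:R + 0 by rewrite addr0.
have uX w (l : 'I_D0.+1) (w' : W) : \sum_j u w j * 0 = 0 :> R.
  by rewrite big1 // => j _; rewrite mulr0.
have cU : chain_poly c = U by apply: chain_poly_coef.
have eV := chain_twistM Mpos uX; set N := mxf (chain_add _ _ _) in eV.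
have UV := chain_twist_equiv upos; rewrite cU in UV.
have Vinv : invertible (chain_twist pos u).
  by apply: (chain_twist_invertible upos); rewrite cU.
have [F [hF EF FE]] := El_inv hM; case: Vinv => V' VV' V'V.
have [|q hq] := @I_sub_tmx_nilpotent _ _ N (F *m V').
  by rewrite -eV mulmxA -(mulmxA F) V'V mulmx1 FE.
exists #|W|, N, q; split; last exact: hq.
apply: El_equiv_trans (El_equiv_sym UV) _; apply: El_equiv_sym; rewrite -eV.
rewrite -[X in El_equiv X _]mul1mx mulmxA; apply: El_equiv_mul => //; exact: El_one.
Qed.
End Higman.

(** * Transfer along t -> t^m *)

Section Extend.
Variable R : nzRingType.

(** If [T'] is listed with the image of [h] first, [f'] becomes a stabilization of [f]; reordering
    is conjugation by the permutation matrices [P] and [Q]. *)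
Lemma El_equiv_extend (T T' : finType) (h : T -> T') (f : T -> T -> R) (f' : T' -> T' -> R) :
  injective h -> (forall a b, f' (h a) (h b) = f a b) ->
  (forall x y, (x \notin codom h) || (y \notin codom h) -> f' x y = (x == y)%:R) ->
  El_equiv (mxf f') (mxf f).
Proof.
move=> hinj ff' f'1.
pose s := [seq h x | x <- enum T] ++ [seq y <- enum T' | y \notin codom h].
have us : uniq s.
  rewrite cat_uniq map_inj_uniq ?enum_uniq // filter_uniq ?enum_uniq // andbT.
  apply/hasPn => y; rewrite mem_filter => /andP[ny _].
  by apply: contra ny => /mapP[x _ ->]; apply: codom_f.
have ms y : y \in s.
  rewrite mem_cat mem_filter mem_enum; case: (boolP (y \in codom h)); rewrite ?orbT //.
have ss : size s = #|T'|.
  rewrite cardT; apply: perm_size; apply: uniq_perm; rewrite ?enum_uniq //.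
  by move=> y; rewrite ms mem_enum.
have nN : (#|T| <= #|T'|)%N by rewrite -ss size_cat size_map -cardE leq_addr.
pose st := Tuple (introT eqP ss).
pose sg (i : 'I_#|T'|) := tnth st i.
have sginj : injective sg by apply/tuple_uniqP.
have sgbij : bijective sg by apply: inj_card_bij; rewrite // card_ord.
have [sv sgK svK] := sgbij.
pose P : 'M[R]_#|T'| := \matrix_(i, j) (enum_val i == sg j)%:R.
pose Q : 'M[R]_#|T'| := \matrix_(i, j) (sg i == enum_val j)%:R.
have PQ : P *m Q = 1%:M.
  apply/matrixP=> i j; rewrite !mxE (bigD1 (sv (enum_val i))) //= !mxE svK eqxx mul1r.
  rewrite (inj_eq enum_val_inj) big1 ?addr0 // => l; rewrite !mxE => hl.
  by rewrite (_ : enum_val i == sg l = false) ?mul0r //; apply: contraNF hl => /eqP ->; rewrite sgK.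
have QP : Q *m P = 1%:M.
  apply/matrixP=> i j; rewrite !mxE (bigD1 (enum_rank (sg i))) //= !mxE enum_rankK eqxx mul1r.
  rewrite (inj_eq sginj) big1 ?addr0 // => l; rewrite !mxE => hl.
  by rewrite (_ : sg i == enum_val l = false) ?mul0r //; apply: contraNF hl => /eqP ->; rewrite enum_valK.
apply: El_equiv_trans (El_equiv_stab (mxf f) nN).
apply: El_equiv_sym; suff -> : stab #|T'| (mxf f) = Q *m mxf f' *m P by apply: El_equiv_conj.
have QM (M : 'M[R]_#|T'|) i j : (Q *m M) i j = M (enum_rank (sg i)) j.
  rewrite mxE (bigD1 (enum_rank (sg i))) //= !mxE enum_rankK eqxx mul1r big1 ?addr0 // => l hl.
  by rewrite !mxE (_ : sg i == enum_val l = false) ?mul0r //; apply: contraNF hl => /eqP ->; rewrite enum_valK.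
have MP (M : 'M[R]_#|T'|) i j : (M *m P) i j = M i (enum_rank (sg j)).
  rewrite mxE (bigD1 (enum_rank (sg j))) //= !mxE enum_rankK eqxx mulr1 big1 ?addr0 // => l hl.
  by rewrite !mxE (_ : enum_val l == sg j = false) ?mulr0 //; apply: contraNF hl => /eqP <-; rewrite enum_valK.
have sgl (i : 'I_#|T'|) (i' : 'I_#|T|) : val i' = val i -> sg i = h (enum_val i').
  move=> e; rewrite /sg (tnth_nth (h (enum_val i'))) /= /s nth_cat size_map -cardE -e ltn_ord.
  by rewrite (nth_map (enum_val i')) -?cardE ?ltn_ord // -enum_val_nth.
have sgr (i : 'I_#|T'|) : (#|T| <= i)%N -> sg i \notin codom h.
  move=> e; have y0 := sg i; rewrite /sg (tnth_nth y0) /= /s nth_cat size_map -cardE ltnNge e /=.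
  have := mem_nth y0 (s := [seq y <- enum T' | y \notin codom h]) (n := i - #|T|).
  rewrite mem_filter => h1; have [|//] := andP (h1 _).
  by rewrite -(ltn_add2l #|T|) subnKC // [X in (_ < X + _)%N]cardE -(size_map h) -size_cat -/s ss.
apply/matrixP=> i j; rewrite MP QM mxf_rank mxE.
case: insubP => [i' _ ei|ni]; last first.
  by rewrite f'1 ?(inj_eq sginj) // sgr // leqNgt.
case: insubP => [j' _ ej|nj]; last first.
  by rewrite f'1 ?(inj_eq sginj) // (sgr j) ?orbT // leqNgt.
by rewrite (sgl i i') // (sgl j j') // ff' mxE.
Qed.

End Extend.

Lemma mulmx_scalarE (R : pzSemiRingType) m n (A : 'M[R]_(m, n)) (c : R) i j :
  (A *m c%:M) i j = A i j * c.
Proof.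
rewrite mxE (bigD1 j) //= !mxE eqxx mulr1n big1 ?addr0 // => k /negPf kj.
by rewrite mxE kj mulr0.
Qed.

Section Transfer.
Variables (R : nzRingType) (m : nat).
Local Notation P := {poly R}.

(* Multiplication by [t] on [R[t]], as a matrix over [R[s]] with [s = t^m.+1], *)
(* in the basis [1, t, ..., t^m].                                             *)
Definition tshift : 'M[P]_m.+1 := \matrix_(a, b)
  ((b == a.+1 :> nat)%:R + ((a == m :> nat) && (b == 0%N :> nat))%:R * 'X).

Definition transfer_base : {rmorphism R -> 'M[P]_m.+1} := (scalar_mx \o polyC).

Lemma tshift_comm : commr_rmorph transfer_base tshift.
Proof.
move=> r; rewrite /GRing.comm; apply/matrixP=> a b.
rewrite -!mulmxE /= mulmx_scalarE mul_scalar_mx !mxE mulrDl mulrDr.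
by rewrite mulr_natl mulr_natr -!mulrA -commr_polyX !mulrA mulr_natl mulr_natr.
Qed.

Definition transfer_ring : {rmorphism P -> 'M[P]_m.+1} := horner_morph tshift_comm.

(** For [i <= m.+1], the product t^a t^i wraps around at most once: it is t^(a+i) or s t^(a+i-m-1),
    and the two indicators tell which. *)
Lemma tshift_exp i (a b : 'I_m.+1) : (i <= m.+1)%N ->
  (tshift ^+ i) a b = ((b == (a + i)%N :> nat)%:R + ((b + m.+1)%N == (a + i)%N :> nat)%:R * 'X).
Proof.
elim: i b => [|i IH] b hi.
  rewrite expr0 mxE addn0 eq_sym -val_eqE /= [X in _ + X](_ : _ = 0) ?addr0 //.
  by rewrite gtn_eqF ?mul0r // ltn_addl.
rewrite exprSr -mulmxE mxE.
under eq_bigr => k _ do rewrite IH ?(ltnW hi) // mxE.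
have [h|h] := ltnP (a + i) m.+1.
  rewrite (bigD1 (Ordinal h)) //= eqxx big1 ?addr0 => [|k]; last first.
    rewrite -val_eqE /= => /negPf->.
    by rewrite gtn_eqF ?mul0r ?addr0 ?mul0r // (leq_trans h) // leq_addl.
  rewrite [X in (1 + X) * _](_ : _ = 0); last first.
    by rewrite gtn_eqF ?mul0r // (leq_trans h) // leq_addl.
  rewrite addr0 mul1r addnS; congr (_ + _%:R * 'X).
  rewrite addnS eqSS; congr nat_of_bool; apply/idP/eqP; first by move=> /andP[/eqP /= e /eqP ->]; rewrite e.
  by move=> e; apply/andP; split; apply/eqP; move: h e => /=; lia.
have ai : (a + i - m.+1 < m.+1)%N by have := ltn_ord a; lia.
rewrite (bigD1 (Ordinal ai)) //= subnK // eqxx.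
rewrite big1 ?addr0 => [|k]; last first.
  rewrite -val_eqE /= => hk; rewrite ltn_eqF ?(leq_trans (ltn_ord k)) // add0r.
  rewrite (_ : (k + m.+1)%N == (a + i)%N = false) ?mul0r ?mul0r //.
  by apply/negbTE; move: hk; apply: contra => /eqP <-; rewrite addnK.
have -> : (a + i - m.+1 == a + i)%N = false by lia.
have -> : (a + i - m.+1 == m)%N = false by have := ltn_ord a; lia.
have -> : (b == a + i.+1 :> nat)%N = false by have := ltn_ord b; lia.
have -> : (b + m.+1 == a + i.+1)%N = (b == (a + i - m.+1).+1 :> nat) by lia.
by rewrite !mul0r !addr0 !add0r mul1r mulr_natl mulr_natr.
Qed.

Lemma transferX : transfer_ring 'X = tshift.
Proof. exact: horner_morphX. Qed.

Lemma transferC r : transfer_ring r%:P = r%:P%:M.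
Proof. exact: horner_morphC. Qed.

(** t^(m+1) acts as the scalar s. Hence the transfer of U(t^(m+1)) is a sum of m + 1 copies of U. *)
Lemma transfer_comp (p : P) : transfer_ring (p \Po 'X^(m.+1)) = p%:M.
Proof.
rewrite comp_polyE rmorph_sum.
have h : tshift ^+ m.+1 = ('X : P)%:M.
  apply/matrixP=> a b; rewrite tshift_exp // !mxE eqn_add2r [_ == a :> nat]eq_sym.
  rewrite [X in X + _](_ : _ = 0) ?add0r ?mulr_natl //.
  by rewrite ltn_eqF // ltn_addl.
under eq_bigr => i _.
  rewrite -mul_polyC rmorphM transferC -exprM rmorphXn transferX exprM h.
  rewrite -rmorphXn -rmorphM mul_polyC.
over.
by rewrite -rmorph_sum -poly_def coefK.
Qed.

Definition transfer n (A : 'M[P]_n) :=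
  mxf (fun x y : 'I_n * 'I_m.+1 => transfer_ring (A x.1 y.1) x.2 y.2).

Lemma transfer_mul n (A B : 'M[P]_n) : transfer (A *m B) = transfer A *m transfer B.
Proof.
rewrite /transfer mxf_mul; apply: eq_mxf => x y; rewrite mxE rmorph_sum summxE.
rewrite (eq_bigr _ (fun k _ => congr1 (fun M : 'M_m.+1 => M x.2 y.2) (rmorphM _ _ _))).
under eq_bigr => k _ do rewrite mxE.
by rewrite pair_bigA.
Qed.

Lemma transfer1 n : transfer (1%:M : 'M[P]_n) = 1%:M.
Proof.
rewrite /transfer mxf1; apply: eq_mxf => -[i a] [j b]; rewrite mxE rmorph_nat /=.
by rewrite xpair_eqE; case: (i == j); rewrite ?mxE.
Qed.

Lemma transfer_El n (E : 'M[P]_n) : El E -> El (transfer E).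
Proof.
elim=> [|i j r E' ij _ IH]; first by rewrite transfer1; apply: El_one.
rewrite transfer_mul; apply: El_mulmx => //.
pose Y (x y : 'I_n * 'I_m.+1) := ((x.1 == i) && (y.1 == j))%:R * transfer_ring r x.2 y.2.
have -> : transfer (1%:M + r *: delta_mx i j) = 1%:M + mxf Y.
  rewrite -transfer1 /transfer; apply/matrixP=> a b; rewrite !mxE rmorphD mxE /=; congr (_ + _).
  by rewrite /Y; case: (_ && _); rewrite ?mulr1 ?mulr0 ?rmorph0 ?mxE ?mul1r ?mul0r.
apply: (El_support (P := fun a => (enum_val a).1 == i)) => a b; rewrite mxE /Y.
case: ((enum_val a).1 =P i) => /= _; last by rewrite mul0r eqxx.
case: ((enum_val b).1 =P j) => [-> _|_]; last by rewrite mul0r eqxx.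
by rewrite eq_sym.
Qed.

Lemma transfer_stab n N (A : 'M[P]_n) : (n <= N)%N ->
  El_equiv (transfer (stab N A)) (transfer A).
Proof.
move=> nN.
apply: (El_equiv_extend (h := fun x : 'I_n * 'I_m.+1 => (widen_ord nN x.1, x.2))).
- by move=> [i a] [j b] [/= /val_inj -> ->].
- by move=> [i a] [j b] /=; rewrite mxE /= !valK.
move=> [i a] [j b] /= h.
suff -> : stab N A i j = (i == j)%:R.
  by rewrite rmorph_nat xpair_eqE; case: (i == j); rewrite ?mxE.
rewrite mxE; case: insubP => // i' _ ei; case: insubP => // j' _ ej.
case/orP: h => /codomP; case; [exists (i', a)|exists (j', b)]; congr pair; exact: val_inj.
Qed.

Lemma transfer_equiv k n (A : 'M[P]_k) (B : 'M[P]_n) :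
  El_equiv A B -> El_equiv (transfer A) (transfer B).
Proof.
case=> N [E [F [mN nN hE hF e]]].
apply: El_equiv_trans (El_equiv_sym (transfer_stab A mN)) _.
apply: El_equiv_trans (transfer_stab B nN); rewrite e !transfer_mul.
by apply: El_equiv_mul; apply: transfer_El.
Qed.

(** Split tN into the part [A] that raises the exponent and the part that wraps from m to 0.
    Factoring out [1 - A] turns the latter into [Y], whose row of exponent a holds s N^(m+1-a) in
    column 0. At a = 0 this is zero by hypothesis, so [Y] has no entry from exponent 0 to itself and
    both factors are elementary. *)
Lemma transfer_nilpotent n (N : 'M[R]_n) : N ^+ m.+1 = 0 -> El (transfer (I_sub_tmx N)).
Proof.
move=> N0.
pose A (x y : 'I_n * 'I_m.+1) : P := (N x.1 y.1)%:P * (y.2 == x.2.+1 :> nat)%:R.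
pose Y (x y : 'I_n * 'I_m.+1) : P :=
  (y.2 == 0%N :> nat)%:R * ('X * ((N ^+ (m.+1 - x.2)) x.1 y.1)%:P).
have -> : transfer (I_sub_tmx N) = (1%:M - mxf A) *m (1%:M - mxf Y).
  rewrite mulmxBl mul1mx mulmxBr mulmx1 mxf_mul mxf1.
  apply/matrixP=> s t; rewrite !mxE; move: (enum_val s) (enum_val t) => [i a] [j b] /=.
  rewrite -[RHS]addrA -opprD rmorphB mxE rmorph_nat [X in _ + X]mxE; congr (_ - _).
    by rewrite xpair_eqE; case: (i == j); rewrite ?mxE.
  rewrite rmorphM transferX transferC -mulmxE mulmx_scalarE mxE.
  rewrite (_ : \sum_z _ = (b == 0%N :> nat)%:R *
    ((a < m)%N%:R * ('X * ((N ^+ (m.+1 - a)) i j)%:P))); last first.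
    rewrite -(pair_bigA _ (fun k c => A (i, a) (k, c) * Y (k, c) (j, b))) /=.
    have [am|ma] := ltnP a m; last first.
      rewrite mul0r mulr0 big1 // => k _; rewrite big1 // => c _.
      by rewrite /A /= ltn_eqF ?mulr0 ?mul0r // (leq_trans (ltn_ord c)).
    rewrite mul1r (_ : (m.+1 - a = (m.+1 - a.+1).+1)%N); last by rewrite subnSK // ltnW.
    rewrite exprS -mulmxE mxE rmorph_sum !mulr_sumr; apply: eq_bigr => k _.
    rewrite (bigD1 (Ordinal (am : a.+1 < m.+1)%N)) //= big1 ?addr0 => [|c]; last first.
      by rewrite -val_eqE /= /A /= => /negPf->; rewrite mulr0 mul0r.
    rewrite /A /Y /= eqxx mulr1 rmorphM /= !mulr_natl mulrnAr (mulrA 'X).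
    by rewrite -(commr_polyX (N i k)%:P) -mulrA.
  rewrite /A /Y /=; case: (b =P 0%N :> nat) => [->|_]; last first.
    by rewrite andbF !mul0r addr0 add0r subr0 mulr_natl mulr_natr.
  rewrite !mul1r andbT mulr0 add0r sub0r; have [am|ma] := ltnP a m.
    by rewrite ltn_eqF // !mul0r mul1r subrr.
  have -> : (a : nat) = m by have := ltn_ord a; lia.
  by rewrite eqxx mul0r subr0 mul1r subSnn expr1.
apply: El_mulmx.
  rewrite -[- mxf A]scaleN1r; apply: (El_graded (d := fun s => (@enum_val ('I_n * 'I_m.+1)%type predT s).2 : nat)) => s t.
  rewrite !mxE /A; case: ((enum_val t).2 =P (enum_val s).2.+1 :> nat) => [->|_].
    by rewrite ltnSn.
  by rewrite mulr0 mulr0 eqxx.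
rewrite -[- mxf Y]scaleN1r.
apply: (El_support (P := fun s => (@enum_val ('I_n * 'I_m.+1)%type predT s).2 != 0%N :> nat)) => s t.
rewrite !mxE /Y /=; case: ((enum_val t).2 =P 0%N :> nat) => [e|_]; last first.
  by rewrite mul0r mulr0 eqxx.
rewrite andbT; apply: contraNneq => ->.
by rewrite subn0 N0 mxE polyC0 !mulr0.
Qed.

End Transfer.

Lemma El_equiv_mxf_ord (R : nzRingType) n (U : 'M[R]_n) :
  El_equiv (mxf (fun i j : 'I_n => U i j)) U.
Proof.
pose P : 'M[R]_(#|'I_n|, n) := \matrix_(i, j) (enum_val i == j)%:R.
pose Q : 'M[R]_(n, #|'I_n|) := \matrix_(i, j) (i == enum_val j)%:R.
have PE p (M : 'M[R]_(n, p)) i j : (P *m M) i j = M (enum_val i) j.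
  rewrite mxE (bigD1 (enum_val i)) //= mxE eqxx mul1r big1 ?addr0 // => k hk.
  by rewrite mxE eq_sym (negPf hk) mul0r.
have QE p (M : 'M[R]_(p, n)) i j : (M *m Q) i j = M i (enum_val j).
  rewrite mxE (bigD1 (enum_val j)) //= mxE eqxx mulr1 big1 ?addr0 // => k hk.
  by rewrite mxE (negPf hk) mulr0.
have -> : mxf (fun i j : 'I_n => U i j) = P *m U *m Q.
  by apply/matrixP=> i j; rewrite QE PE mxE.
apply: El_equiv_conj; first exact: card_ord.
  by apply/matrixP=> i j; rewrite QE !mxE (inj_eq enum_val_inj).
apply/matrixP=> i j; rewrite !mxE (bigD1 (enum_rank i)) //= !mxE enum_rankK eqxx mul1r.
rewrite big1 ?addr0 // => k; rewrite -(inj_eq enum_val_inj) enum_rankK !mxE eq_sym.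
by move=> /negPf->; rewrite mul0r.
Qed.

(** * Infinitely many classes among the substitutions t -> t^m *)

Section Infinite.
Variable R : nzRingType.
Local Notation P := {poly R}.

Lemma psubst_comm m : commr_rmorph (polyC : R -> P) 'X^m.
Proof. by move=> a; apply/commr_sym/commr_polyXn. Qed.

Definition psubst m : {rmorphism P -> P} := horner_morph (psubst_comm m).

Lemma psubstE m p : psubst m p = p \Po 'X^m.
Proof. by []. Qed.

Definition copies m n (U : 'M[P]_n) :=
  mxf (fun x y : 'I_n * 'I_m => if x.2 == y.2 then U x.1 y.1 else 0).

Lemma transfer_psubst m n (U : 'M[P]_n) :
  transfer m (map_mx (psubst m.+1) U) = copies m.+1 U.
Proof.
apply: eq_mxf => x y; rewrite !mxE psubstE transfer_comp mxE.
by case: (x.2 == y.2).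
Qed.

(** [copies m.+1 U] is the product of [f1], which is U on copy 0 and the identity elsewhere, and
    [f2], which is the identity on copy 0 and U on the other copies. Triviality of the product and
    of [f2] gives that of [f1]. *)
Lemma stably_El_copies m n (U : 'M[P]_n) :
  stably_El (copies m U) -> stably_El (copies m.+1 U) -> stably_El U.
Proof.
move=> h1 h2.
pose f1 (x y : 'I_n * 'I_m.+1) : P :=
  if (x.2 == ord0) && (y.2 == ord0) then U x.1 y.1 else (x == y)%:R.
pose f2 (x y : 'I_n * 'I_m.+1) : P :=
  if (x.2 == ord0) || (y.2 == ord0) then (x == y)%:R
  else if x.2 == y.2 then U x.1 y.1 else 0.
have e2 : El_equiv (mxf f2) (copies m U).
  apply: (El_equiv_extend (h := fun x : 'I_n * 'I_m => (x.1, lift ord0 x.2))).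
  - by move=> [i a] [j b] e; have /= -> := congr1 fst e; have /= /lift_inj -> := congr1 snd e.
  - by move=> [i a] [j b]; rewrite /f2 /= (inj_eq lift_inj).
  - move=> [i a] [j b]; rewrite /f2 /=; case: (unliftP ord0 a) => [a'|] ->; last by rewrite eqxx.
    case: (unliftP ord0 b) => [b'|] ->; last by rewrite eqxx orbT.
    by case/orP=> /codomP[]; [exists (i, a')|exists (j, b')].
have e1 : El_equiv (mxf f1) U.
  apply: El_equiv_trans (El_equiv_mxf_ord U).
  apply: (El_equiv_extend (h := fun i : 'I_n => (i, ord0 : 'I_m.+1))).
  - by move=> i j [->].
  - by [].
  - move=> [i a] [j b]; rewrite /f1 /=; case: (a =P ord0) => [->|_] //=.
    case: (b =P ord0) => [->|_] //=.
    by case/orP=> /codomP[]; [exists i|exists j].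
have e12 : copies m.+1 U = mxf f1 *m mxf f2.
  rewrite mxf_mul; apply: eq_mxf => -[i a] [j b].
  rewrite -(pair_bigA _ (fun k c => f1 (i, a) (k, c) * f2 (k, c) (j, b))) /=.
  rewrite (eq_bigr (fun k => f1 (i, a) (k, a) * f2 (k, a) (j, b))) => [|k _]; last first.
    rewrite (bigD1 a) //= big1 ?addr0 // => c ca; rewrite /f1 /=.
    rewrite xpair_eqE [a == c]eq_sym (negPf ca) andbF.
    by case: (a =P ord0) ca => [->|_] /=; case: (c =P ord0) => [->|_] /=; rewrite ?eqxx ?mul0r.
  have [->|a0] := eqVneq a ord0.
    rewrite (bigD1 j) //= /f1 /f2 /= xpair_eqE eqxx /= big1 => [|k /negPf kj].
      by rewrite addr0; case: (ord0 == b); rewrite ?mulr1 ?mulr0.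
    by rewrite xpair_eqE kj mulr0.
  rewrite (bigD1 i) //= /f1 /f2 /= (negPf a0) /= eqxx mul1r big1 => [|k /negPf ki].
    rewrite addr0; case: (b =P ord0) => [->|//].
    by rewrite xpair_eqE (negPf a0) andbF.
  by rewrite xpair_eqE eq_sym ki mul0r.
rewrite e12 in h2.
apply: stably_El_equiv (El_equiv_sym e1) _.
by apply: stably_El_cancel h2 _; apply: stably_El_equiv e2 h1.
Qed.

Lemma psubst_at0 m n (U : 'M[P]_n) : (0 < m)%N ->
  map_mx (coefp 0) (map_mx (psubst m) U) = map_mx (coefp 0) U.
Proof.
move=> m0; apply/matrixP=> i j; rewrite !mxE psubstE /= coef_comp_poly_Xn //.
by rewrite dvdn0 div0n.
Qed.

Lemma transfer_psubst_trivial n (U : 'M[P]_n) m' :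
  map_mx (coefp 0) U = 1%:M -> invertible U -> (0 < m')%N ->
  exists K, forall m, (K <= m)%N -> stably_El (transfer m (map_mx (psubst m') U)).
Proof.
move=> U0 Uinv m0.
have [|p [N [q [e N0]]]] := Higman_linearization _ (invertible_map (psubst m') Uinv).
  by rewrite psubst_at0.
exists q => m qm; apply: stably_El_equiv (transfer_equiv m e) _.
apply: El_stably_El; apply: transfer_nilpotent.
by rewrite -(subnK (leqW qm)) exprD N0 mulr0.
Qed.

(* The transfer F_m satisfies F_m V_m = m and kills every class for m large;  *)
(* if the classes V_m [U] were finitely many, then m [U] = 0 for all large m, *)
(* hence [U] = (m + 1) [U] - m [U] = 0.                                       *)
Lemma psubst_infinite n (U : 'M[P]_n) :
  map_mx (coefp 0) U = 1%:M -> invertible U -> ~ stably_El U ->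
  forall M, exists2 m, (M < m)%N & forall m', (0 < m' <= M)%N ->
    ~ El_equiv (map_mx (psubst m) U) (map_mx (psubst m') U).
Proof.
move=> U0 Uinv nU M; apply: contrapT => hM.
have [K hK] : exists K, forall m' m, (0 < m' <= M)%N -> (K <= m)%N ->
    stably_El (transfer m (map_mx (psubst m') U)).
  elim: M {hM} => [|M [K IH]].
    by exists 0%N => m' m /andP[m0 m1]; rewrite ltnNge m1 in m0.
  have [K' hK'] := transfer_psubst_trivial U0 Uinv (ltn0Sn M).
  exists (maxn K K') => m' m /andP[m0]; rewrite geq_max leq_eqVlt ltnS => /orP[/eqP ->|m1] /andP[h h'].
    exact: hK'.
  by apply: IH => //; rewrite m0.
have big m : (maxn K M <= m)%N -> stably_El (copies m.+1 U).
  rewrite geq_max => /andP[Km Mm].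
  have [m' hm' e] : exists2 m', (0 < m' <= M)%N &
      El_equiv (map_mx (psubst m.+1) U) (map_mx (psubst m') U).
    apply: contrapT => hn; apply: hM; exists m.+1; rewrite ?ltnS // => m' hm' e.
    by apply: hn; exists m'.
  rewrite -transfer_psubst; apply: stably_El_equiv (transfer_equiv m e) _.
  exact: hK.
apply: nU; pose m := maxn K M.
apply: (@stably_El_copies m.+1); apply: big => //; exact: leqW.
Qed.
End Infinite.

(** * Triviality of NK_1(Z) *)

Lemma I_sub_tmx_conj (R : nzRingType) n (P Q A : 'M[R]_n) :
  P *m Q = 1%:M -> Q *m P = 1%:M -> El_equiv (I_sub_tmx (P *m A *m Q)) (I_sub_tmx A).
Proof.
move=> PQ QP.
have -> : I_sub_tmx (P *m A *m Q) = map_mx polyC P *m I_sub_tmx A *m map_mx polyC Q.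
  rewrite /I_sub_tmx mulmxBr mulmxBl mulmx1 mulmx_scaleX -scalemxAl -!map_mxM.
  by rewrite PQ map_mx1.
by apply: El_equiv_conj; rewrite // -map_mxM ?PQ ?QP map_mx1.
Qed.

Lemma drsubmx_exp (R : nzRingType) m n (A : 'M[R]_(m + n)) q :
  ursubmx A = 0 -> drsubmx (A ^+ q) = (drsubmx A) ^+ q /\ ursubmx (A ^+ q) = 0.
Proof.
move=> A0; elim: q => [|q [IH1 IH2]].
  by rewrite !expr0 -[1]/(1%:M) (scalar_mx_block m n 1) block_mxKdr block_mxKur.
rewrite !exprS -IH1.
have -> : A * A ^+ q = block_mx (ulsubmx A) (ursubmx A) (dlsubmx A) (drsubmx A) *m
    block_mx (ulsubmx (A ^+ q)) (ursubmx (A ^+ q)) (dlsubmx (A ^+ q)) (drsubmx (A ^+ q)).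
  by rewrite !submxK.
by rewrite A0 IH2 mulmx_block block_mxKdr block_mxKur !mulmx0 mul0mx !add0r.
Qed.

Lemma I_sub_tmx_block_lower (R : nzRingType) m n (A : 'M[R]_(m + n)) :
  ulsubmx A = 0 -> ursubmx A = 0 ->
  I_sub_tmx A = block_mx 1%:M 0 (- ('X *: map_mx polyC (dlsubmx A))) 1%:M *m
    block_mx (1%:M : 'M_m) 0 0 (I_sub_tmx (drsubmx A)) *m 1%:M.
Proof.
move=> ul ur; rewrite mulmx1 mulmx_block !(mulmx0, mul0mx, mulmx1, mul1mx, addr0, add0r).
rewrite /I_sub_tmx -[X in map_mx _ X](submxK A) ul ur map_block_mx.
rewrite !map_mx0 scale_block_mx !scaler0 (scalar_mx_block m n 1) opp_block_mx add_block_mx.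
by rewrite !oppr0 !addr0 add0r.
Qed.

(** A nonzero row of the last nonvanishing power of [N] will do. *)
Lemma left_null_row n (N : 'M[int]_n.+1) q : N ^+ q = 0 ->
  exists2 v : 'rV[int]_n.+1, v != 0 & v *m N = 0.
Proof.
elim: q => [|q IH] N0.
  by move/matrixP/(_ ord0 ord0): N0; rewrite expr0 !mxE eqxx.
have [/IH //|nz] := eqVneq (N ^+ q) 0.
have /matrix0Pn[i [j hij]] := nz.
exists (row i (N ^+ q)); first by apply/rV0Pn; exists j; rewrite mxE.
by rewrite -row_mul -[_ *m _]/(N ^+ q * N) -exprSr N0 row0.
Qed.

(** The Smith form of the single row [v] makes it a nonzero integer multiple [c] of the first row of
    a unimodular matrix, and [c] can be cancelled. *)
Lemma unimodular_null_row n (N : 'M[int]_n.+1) q : N ^+ q = 0 ->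
  exists2 P : 'M[int]_n.+1, P \in unitmx & row ord0 P *m N = 0.
Proof.
case/left_null_row=> v v0 vN; have [L Lu [P Pu [d _ e]]] := int_Smith_normal_form v.
exists P => //; pose c := L ord0 ord0 * d`_0.
have ve : v = c *: row ord0 P.
  apply/rowP=> j; rewrite e !mxE (bigD1 ord0) //= big1 ?addr0 => [|k k0]; last first.
    rewrite !mxE big1 ?mul0r // => l _; rewrite !mxE ord1 /= eq_sym.
    by rewrite -[0%N]/(val (ord0 : 'I_n.+1)) val_eqE (negPf k0) mulr0n mulr0.
  by rewrite !mxE big_ord1 !mxE eqxx mulr1n.
have c0 : c != 0 by apply: contraNneq v0 => c0; rewrite ve c0 scale0r.
move: vN; rewrite ve -scalemxAl => /eqP; rewrite scalemx_eq0 (negPf c0) /=.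
by move/eqP.
Qed.

(* [NK1 Z = 0]: an integer nilpotent matrix is GL(Z)-conjugate to a triangular one. *)
Lemma int_nilpotent_stably_El n (N : 'M[int]_n) q : N ^+ q = 0 -> stably_El (I_sub_tmx N).
Proof.
elim: n N => [|n IH] N N0.
  by apply: El_stably_El; rewrite [I_sub_tmx N](_ : _ = 1%:M); [exact: El_one|apply/matrixP=> -[]].
have [P Pu rN] := unimodular_null_row N0.
apply: stably_El_equiv (El_equiv_sym (I_sub_tmx_conj N (mulmxV Pu) (mulVmx Pu))) _.
set N' := P *m N *m invmx P.
have N'q : N' ^+ q = 0.
  have -> : N' ^+ q = P *m N ^+ q *m invmx P.
    elim: (q) => [|p IHq]; first by rewrite expr0 mulmx1 mulmxV.
    by rewrite exprS IHq exprS -!mulmxE /N' !mulmxA mulmxKV.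
  by rewrite N0 mulmx0 mul0mx.
have r0 j : N' ord0 j = 0.
  have : row ord0 N' = 0 by rewrite /N' !row_mul rN mul0mx.
  by move/rowP/(_ j); rewrite !mxE.
clearbody N'.
have ur : @ursubmx _ 1 n 1 n N' = 0.
  by apply/matrixP=> i j; rewrite !mxE -[RHS](r0 (rshift 1 j)); congr (N' _ _); apply: val_inj; rewrite ord1.
have ul : @ulsubmx _ 1 n 1 n N' = 0.
  by apply/matrixP=> i j; rewrite !mxE -[RHS](r0 (lshift n j)); congr (N' _ _); apply: val_inj; rewrite ord1.
have dr : @drsubmx _ 1 n 1 n N' ^+ q = 0.
  have [<- _] := @drsubmx_exp _ 1 n N' q ur; rewrite N'q.
  by apply/matrixP=> i j; rewrite !mxE.
rewrite (@I_sub_tmx_block_lower _ 1 n N' ul ur).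
apply: stably_El_equiv (IH _ dr).
apply: El_equiv_trans (El_equiv_block1 1 _).
by apply: El_equiv_mul; [exact: (@El_block_lower _ 1 n)|exact: El_one].
Qed.

Lemma int_NK1_trivial n (U : 'M[{poly int}]_n) :
  map_mx (coefp 0) U = 1%:M -> invertible U -> stably_El U.
Proof.
move=> U0 Ui; have [p [N [q [e N0]]]] := Higman_linearization U0 Ui.
by apply: stably_El_equiv e _; apply: int_nilpotent_stably_El N0.
Qed.

(** * Classes in NK_1 and the elementary stabilizer *)

Section K1Classes.
Variable R : nzRingType.

Lemma stably_El_at n (A : 'M[R]_n) : stably_El A ->
  exists2 N0 : nat, (n <= N0)%N & forall N, (N0 <= N)%N -> El (stab N A).
Proof.
case=> N0 nN0 h; exists N0 => // N N0N.
by rewrite -(stab_stab A nN0 N0N); apply: stab_El.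
Qed.

Lemma El_equiv_stably n (X A Y : 'M[R]_n) :
  stably_El X -> stably_El Y -> El_equiv (X *m A *m Y) A.
Proof.
move=> /stably_El_at[N1 n1 h1] /stably_El_at[N2 _ h2]; pose N := maxn N1 N2.
have nN : (n <= N)%N by rewrite leq_max n1.
exists N, (stab N X), (stab N Y); split; rewrite ?stab_mul //.
  by apply: h1; rewrite leq_maxl.
by apply: h2; rewrite leq_maxr.
Qed.

Lemma K1_class_refl (U : GL R) : K1_class U U.
Proof. by exists (GL_size U), 1%:M; split; rewrite ?mulmx1 //; apply: El_one. Qed.

Lemma K1_class_stably_El (U V : GL R) : K1_class U V ->
  stably_El (GL_mx U) <-> stably_El (GL_mx V).
Proof.
case=> N [E [uN vN hE e]].
have [F [hF EF FE]] := El_inv hE.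
have uv : El_equiv (GL_mx V) (GL_mx U).
  by exists N, 1%:M, E; split; rewrite ?mul1mx //; apply: El_one.
split; first exact: stably_El_equiv.
exact/stably_El_equiv/El_equiv_sym.
Qed.

Lemma stably_El_K1_class (U V : GL R) :
  stably_El (GL_mx U) -> stably_El (GL_mx V) -> K1_class U V.
Proof.
move=> /stably_El_at[N1 u1 h1] /stably_El_at[N2 v2 h2]; pose N := maxn N1 N2.
have [F [hF EF FE]] := El_inv (h1 N (leq_maxl _ _)).
exists N, (F *m stab N (GL_mx V)); split; rewrite ?leq_max ?u1 ?v2 ?orbT //.
  by apply: El_mulmx => //; apply: h2; rewrite leq_maxr.
by rewrite mulmxA EF mul1mx.
Qed.

Lemma stably_El_unit0 : stably_El (GL_mx (MkGL (invertible1 R))).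
Proof. by apply: El_stably_El; apply: El_one. Qed.

Lemma K1_0P (U : GL R) : K1_0 R U <-> stably_El (GL_mx U).
Proof.
split=> [/K1_class_stably_El[h _]|h]; first by apply: h; apply: stably_El_unit0.
by apply: stably_El_K1_class => //; apply: stably_El_unit0.
Qed.

Lemma K1_class_eq0 (U : GL R) : K1_class U = K1_0 R <-> stably_El (GL_mx U).
Proof.
split=> [e|h]; first by apply/K1_0P; rewrite -e; apply: K1_class_refl.
apply/seteqP; split=> V; last by move/K1_0P; apply: stably_El_K1_class.
by move/K1_class_stably_El=> hUV; apply/K1_0P/hUV.
Qed.
End K1Classes.

Lemma stably_El_map (R S : nzRingType) (f : {rmorphism R -> S}) n (A : 'M[R]_n) :
  stably_El A -> stably_El (map_mx f A).
Proof. by case=> N nN h; exists N; rewrite -?map_stab //; apply: map_El. Qed.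

Lemma El_equiv_map (R S : nzRingType) (f : {rmorphism R -> S}) m n (A : 'M[R]_m) (B : 'M[R]_n) :
  El_equiv A B -> El_equiv (map_mx f A) (map_mx f B).
Proof.
case=> N [E [F [mN nN hE hF e]]]; exists N, (map_mx f E), (map_mx f F).
by split; rewrite -?map_stab ?e ?map_mxM //; apply: map_El.
Qed.

Lemma K1_map_class_eq0 (R S : nzRingType) (f : {rmorphism R -> S}) (U : GL R) :
  K1_map f (K1_class U) = K1_0 S <-> stably_El (map_mx f (GL_mx U)).
Proof.
split=> [e|h].
  suff: K1_0 S (GL_map f U) by move/K1_0P.
  by rewrite -e; exists U; apply: K1_class_refl.
apply/seteqP; split=> V.
  case=> U' UU' /K1_class_stably_El hV; apply/K1_0P/hV => /=.
  case: UU' => N [E [uN vN hE e]]; apply: stably_El_equiv h; apply: El_equiv_map.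
  by exists N, 1%:M, E; split; rewrite ?mul1mx //; apply: El_one.
move/K1_0P=> hV; exists U; first exact: K1_class_refl.
exact: stably_El_K1_class.
Qed.

Lemma NK1_class (R : nzRingType) (U : GL {poly R}) :
  NK1 R (K1_class U) <-> stably_El (map_mx (coefp 0) (GL_mx U)).
Proof.
split=> [[_ /K1_map_class_eq0] //|h]; split; first by exists U.
exact/K1_map_class_eq0.
Qed.

Lemma invertible_stab (R : nzRingType) n N (U : 'M[R]_n) : (n <= N)%N ->
  invertible U -> invertible (stab N U).
Proof.
by move=> nN [V UV VU]; exists (stab N V); rewrite -stab_mul // ?UV ?VU stab1.
Qed.

Lemma invertible_mul (R : nzRingType) n (U V : 'M[R]_n) :
  invertible U -> invertible V -> invertible (U *m V).
Proof.
move=> [U' UU' U'U] [V' VV' V'V]; exists (V' *m U').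
  by rewrite mulmxA -(mulmxA U) VV' mulmx1.
by rewrite mulmxA -(mulmxA V') U'U mulmx1.
Qed.

Lemma invertible_El (R : nzRingType) n (E : 'M[R]_n) : El E -> invertible E.
Proof. by case/El_inv=> F [_ EF FE]; exists F. Qed.

Lemma map_coefp0_polyC (R : nzRingType) m n (A : 'M[R]_(m, n)) :
  map_mx (coefp 0) (map_mx polyC A) = A.
Proof. by apply/matrixP=> i j; rewrite !mxE /= coefC eqxx. Qed.

(** For a class in NK_1 the matrix U(0) is only stably elementary. After stabilization, multiplying
    by its constant elementary inverse [F] gives U(0) = I without changing the class. *)
Lemma NK1_nontrivial (R : nzRingType) : NK1 R <> [set K1_0 {poly R}] ->
  exists n (U : 'M[{poly R}]_n),
    [/\ invertible U, map_mx (coefp 0) U = 1%:M & ~ stably_El U].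
Proof.
move=> nt; apply: contrapT => hn; apply: nt; apply/seteqP; split=> c /=; last first.
  move=> ->; apply/NK1_class; apply: stably_El_map; exact: stably_El_unit0.
case=> -[U _ <-] hU; have /NK1_class[N nN hE] : NK1 R (K1_class U) by split=> //; exists U.
apply/K1_class_eq0; apply: contrapT => nU; apply: hn.
have [F [hF EF FE]] := El_inv hE.
exists N, (stab N (GL_mx U) *m map_mx polyC F); split.
- apply: invertible_mul; last exact: (invertible_El (map_El _ hF)).
  by apply: invertible_stab => //; apply: GL_invertible.
- by rewrite map_mxM map_stab map_coefp0_polyC EF.
- move/stably_El_cancel => h; apply: nU.
  apply: stably_El_equiv (El_equiv_sym (El_equiv_stab _ nN)) _.
  by apply: h; apply: El_stably_El; apply: map_El.
Qed.

Lemma elementary_stabilizer_trivial (R : nzRingType) n (A : 'M[R]_n) :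
  elementary_stabilizer A = [set K1_0 {poly R}] ->
  forall N (U : 'M[{poly R}]_N) E, invertible U -> stably_El (map_mx (coefp 0) U) ->
    (n <= N)%N -> El E -> U *m stab N (I_sub_tmx A) = stab N (I_sub_tmx A) *m E ->
    stably_El U.
Proof.
move=> tr N U E Ui U0 nN hE e; pose G := MkGL Ui.
suff: K1_class G = K1_0 {poly R} by move/K1_class_eq0.
suff: elementary_stabilizer A (K1_class G) by rewrite tr.
split; first exact/NK1_class.
by exists G; split=> //; exists N, E; split; rewrite //= stab_id.
Qed.

(* [B] lies in the shift equivalence class of [A], displaced by the class of [U]. *)
Definition displaced (R : nzRingType) b n k (B : 'M[R]_b) (A : 'M[R]_n) (U : 'M[{poly R}]_k) :=
  exists w (V : 'M[{poly R}]_w) (A' : 'M[R]_w),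
    [/\ invertible V, map_mx (coefp 0) V = 1%:M, El_equiv V U,
      El_equiv (I_sub_tmx A') (I_sub_tmx A) & El_equiv (I_sub_tmx B) (V *m I_sub_tmx A')].

Lemma displaced_at (R : nzRingType) b n k (B : 'M[R]_b) (A : 'M[R]_n) (U : 'M[{poly R}]_k) :
  displaced B A U -> exists N0, forall N, (N0 <= N)%N -> exists (W F : 'M[{poly R}]_N),
    [/\ (n <= N)%N, (b <= N)%N, invertible W, El (map_mx (coefp 0) W) &
      [/\ El F, El_equiv W U & stab N (I_sub_tmx B) = W *m stab N (I_sub_tmx A) *m F]].
Proof.
case=> w [V [A' [Vi V0 VU /El_equiv_at[N1 h1] /El_equiv_at[N2 h2]]]].
exists (maxn N1 N2) => N; rewrite geq_max => /andP[N1N N2N].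
have [wN nN [E1 [F1 [hE1 hF1 e1]]]] := h1 N N1N.
have [bN _ [E2 [F2 [hE2 hF2 e2]]]] := h2 N N2N.
exists (E2 *m stab N V *m E1), (F1 *m F2); split=> //.
- apply: invertible_mul; last exact: invertible_El.
  by apply: invertible_mul; [exact: invertible_El|exact: invertible_stab].
- rewrite !map_mxM map_stab V0 stab1 // mulmx1.
  by apply: El_mulmx; apply: map_El.
- split; first exact: El_mulmx.
    by apply: El_equiv_trans (El_equiv_mul _ hE2 hE1) (El_equiv_trans (El_equiv_stab _ wN) VU).
  by rewrite e2 stab_mul // e1 !mulmxA.
Qed.

(** At a common stage W1 (I - tA) F1 = E W2 (I - tA) F2 F. Hence U = W2^-1 E^-1 W1 satisfies U (I -
    tA) = (I - tA) F2 F F1^-1 and represents an element of the stabilizer, so it is trivial, and W1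
    = E W2 U has the class of W2. *)
Lemma displaced_class (R : nzRingType) b1 b2 n k1 k2 (B1 : 'M[R]_b1) (B2 : 'M[R]_b2)
    (A : 'M[R]_n) (U1 : 'M[{poly R}]_k1) (U2 : 'M[{poly R}]_k2) :
  elementary_stabilizer A = [set K1_0 {poly R}] ->
  displaced B1 A U1 -> displaced B2 A U2 -> SSE B1 B2 -> El_equiv U1 U2.
Proof.
move=> tr /displaced_at[N1 h1] /displaced_at[N2 h2] /SSE_El_equiv/El_equiv_at[N3 h3].
pose N := maxn N1 (maxn N2 N3).
have [|W1 [F1 [nN b1N [W1' W1K W1'K] W10 [hF1 e1 B1E]]]] := h1 N; first exact: leq_maxl.
have [|W2 [F2 [_ b2N [W2' W2K W2'K] W20 [hF2 e2 B2E]]]] := h2 N.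
  by rewrite /N maxnCA leq_maxl.
have [|_ _ [E [F [hE hF eB]]]] := h3 N; first by rewrite /N maxnA leq_maxr.
have [E' [hE' EE' E'E]] := El_inv hE; have [F1' [hF1' FF1 F1F]] := El_inv hF1.
pose U := W2' *m E' *m W1.
have hU : stably_El U.
  apply: (elementary_stabilizer_trivial tr (E := F2 *m F *m F1')) => //.
  - apply: invertible_mul; last by exists W1'.
    by apply: invertible_mul; [exists W2|exists E].
  - rewrite /U !map_mxM; apply: stably_El_mulmx; last exact: El_stably_El.
    apply: stably_El_mulmx; last by apply: El_stably_El; apply: map_El.
    apply: (@stably_El_inv _ _ (map_mx (coefp 0) W2)); last exact: El_stably_El.
    by rewrite -map_mxM W2K map_mx1.
  - by do 2![apply: El_mulmx => //].
  rewrite /U; move: eB; rewrite B1E B2E => /(congr1 (fun M => W2' *m E' *m M *m F1')).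
  by rewrite !mulmxA -(mulmxA _ F1) FF1 mulmx1 -(mulmxA W2' E' E) E'E mulmx1 W2'K mul1mx.
apply: El_equiv_trans (El_equiv_sym e1) (El_equiv_trans _ e2).
have -> : W1 = E *m W2 *m U.
  by rewrite /U !mulmxA -(mulmxA E) W2K mulmx1 EE' mul1mx.
apply: El_equiv_stably => //; exact: El_stably_El.
Qed.

(** * Augmentation and normalized classes in NK_1(ZG) *)

Section Augmentation.
Variables (K : nzSemiRingType) (gT : finGroupType).
Local Notation KG := (grpring K gT).

Fact augmentation_is_additive : nmod_morphism (@augmentation K gT).
Proof.
split=> [|x y]; first by rewrite /augmentation big1 // => g _; rewrite ffunE.
by rewrite /augmentation -big_split; apply: eq_bigr => g _; rewrite ffunE.
Qed.

Fact augmentation_is_multiplicative : monoid_morphism (@augmentation K gT).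
Proof.
split=> [|x y].
  by rewrite /augmentation (bigD1 1%g) //= big1 ?ffunE ?eqxx ?addr0 // => g /negPf h; rewrite ffunE h.
rewrite /augmentation mulr_suml; under eq_bigr => g _ do rewrite ffunE.
rewrite exchange_big; apply: eq_bigr => h _ /=.
by rewrite -mulr_sumr [in RHS](reindex_inj (mulgI h^-1%g)).
Qed.

HB.instance Definition _ := GRing.isNmodMorphism.Build KG K (@augmentation K gT)
  augmentation_is_additive.
HB.instance Definition _ := GRing.isMonoidMorphism.Build KG K (@augmentation K gT)
  augmentation_is_multiplicative.
End Augmentation.

Section IntegerCoefficients.
Variable gT : finGroupType.

Fact ZG_of_is_additive : nmod_morphism (@ZG_of gT).
Proof. by split=> [|x y]; apply/ffunP=> g; rewrite !ffunE // PoszD. Qed.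

Fact ZG_of_is_multiplicative : monoid_morphism (@ZG_of gT).
Proof.
split=> [|x y]; apply/ffunP=> g; rewrite !ffunE; first by case: eqP.
by rewrite -natz rmorph_sum; apply: eq_bigr => h _; rewrite !ffunE rmorphM /= !natz.
Qed.

HB.instance Definition _ := GRing.isNmodMorphism.Build (ZpG gT) (ZG gT) (@ZG_of gT)
  ZG_of_is_additive.
HB.instance Definition _ := GRing.isMonoidMorphism.Build (ZpG gT) (ZG gT) (@ZG_of gT)
  ZG_of_is_multiplicative.

Lemma ZG_of_inj : injective (@ZG_of gT).
Proof. by move=> x y /ffunP h; apply/ffunP=> g; have := h g; rewrite !ffunE => -[]. Qed.

Lemma augmentation_ZG_of (x : ZpG gT) : augmentation (ZG_of x) = (augmentation x)%:Z.
Proof.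
rewrite /augmentation -natz rmorph_sum; apply: eq_bigr => g _.
by rewrite ffunE /= natz.
Qed.


(* Dividing by the image of the augmentation changes no class, since NK_1 Z is trivial. *)
Lemma NK1_ZG_normalized : NK1 (ZG gT) <> [set K1_0 {poly ZG gT}] ->
  exists n (U : 'M[{poly ZG gT}]_n),
    [/\ invertible U, map_mx (coefp 0) U = 1%:M,
      map_mx (map_poly (@augmentation int gT)) U = 1%:M & ~ stably_El U].
Proof.
case/NK1_nontrivial=> n [U [Ui U0 nU]]; exists n.
pose f : {rmorphism _ -> _} := map_poly (@augmentation int gT).
pose g : {rmorphism _ -> _} := map_poly (intr : int -> ZG gT).
have coef0 (S S' : nzRingType) (h : {rmorphism S -> S'}) (M : 'M[{poly S}]_n) :
    map_mx (coefp 0) (map_mx (map_poly h) M) = map_mx h (map_mx (coefp 0) M).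
  by apply/matrixP=> i j; rewrite !mxE /= coef_map.
have [V UV VU] := invertible_map f Ui.
have V0 : map_mx (coefp 0) V = 1%:M.
  have := congr1 (map_mx (coefp 0)) UV.
  by rewrite map_mxM coef0 U0 !map_mx1 mul1mx.
have fg p : f (g p) = p.
  by apply/polyP=> i; rewrite !coef_map /= rmorph_int intz.
have gV0 : map_mx (coefp 0) (map_mx g V) = 1%:M by rewrite coef0 V0 map_mx1.
have gVi : invertible (map_mx g V).
  exists (map_mx g (map_mx f U)); rewrite -map_mxM ?VU ?UV map_mx1 //.
exists (U *m map_mx g V); split.
- exact: invertible_mul.
- by rewrite map_mxM U0 gV0 mulmx1.
- rewrite map_mxM -[RHS]UV; congr (_ *m _).
  by apply/matrixP=> i j; rewrite !mxE fg.
- move/stably_El_cancel => h; apply: nU; apply: h; apply: stably_El_map.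
  by apply: int_NK1_trivial => //; exists (map_mx f U).
Qed.
End IntegerCoefficients.

(** * State splitting *)

Section StateMoves.
Variables (S : pzSemiRingType) (W : finType).

Lemma ESSE_sym m n (A : 'M[S]_m) (B : 'M[S]_n) : ESSE A B -> ESSE B A.
Proof. by case=> U [V [-> ->]]; exists V, U. Qed.

Lemma SSE_sym m n (A : 'M[S]_m) (B : 'M[S]_n) : SSE A B -> SSE B A.
Proof.
elim=> {m n A B} [m n A B /ESSE_sym|m n A B p C _ h1 _ h2]; first exact: SSE_step.
exact: SSE_trans h2 h1.
Qed.

Lemma SSE_refl n (A : 'M[S]_n) : SSE A A.
Proof. by apply: SSE_step; exists A, 1%:M; rewrite mulmx1 mul1mx. Qed.

(** The row [v] after the combination [vec] of states is substituted for the state [n0]. *)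
Definition redirect (n0 : W) (vec v : W -> S) (w' : W) : S :=
  v n0 * vec w' + (if w' == n0 then 0 else v w').

(* State splitting, keeping the now unreachable state [n0]. *)
Lemma ESSE_redirect (n0 : W) (vec : W -> S) (M : W -> W -> S) :
  (forall w', M n0 w' = \sum_w vec w * M w w') -> vec n0 = 0 ->
  ESSE (mxf M) (mxf (fun w => redirect n0 vec (M w))).
Proof.
move=> Mn0 v0; pose K w w' := if w == n0 then vec w' else (w == w')%:R.
exists (mxf K), (mxf M); rewrite !mxf_mul; split; apply: eq_mxf => w w'.
  rewrite /K; case: eqP => [->|_]; first exact: Mn0.
  by under eq_bigr => k _ do rewrite eq_sym; rewrite big_delta.
rewrite /redirect (bigD1 n0) //= /K eqxx; congr (_ + _).
rewrite (eq_bigr (fun k => M w k * (k == w')%:R)) => [|k /negPf -> //].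
case: (eqVneq w' n0) => [->|h]; first by rewrite big1 // => k /negPf ->; rewrite mulr0.
rewrite (bigD1 w') ?eqxx //= mulr1 big1 ?addr0 // => k /andP[_ /negPf ->].
by rewrite mulr0.
Qed.

Lemma redirect_id (n0 : W) (vec v : W -> S) : v n0 = 0 -> redirect n0 vec v =1 v.
Proof. by move=> v0 w'; rewrite /redirect v0 mul0r add0r; case: eqP => [->|]. Qed.

Lemma redirect_linear (n0 : W) (vec u v : W -> S) c w' :
  redirect n0 vec (fun w => c * u w + v w) w' =
  c * redirect n0 vec u w' + redirect n0 vec v w'.
Proof.
rewrite /redirect mulrDl mulrDr -mulrA addrACA; congr (_ + _).
by case: eqP; rewrite ?mulr0 ?addr0.
Qed.

(** Erasing the rows of states that no edge enters may leave further states without incoming edges,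
    so that unreachable chains can be removed level by level. *)
Lemma ESSE_zero_rows (D : pred W) (M : W -> W -> S) :
  (forall w w', D w' -> M w w' = 0) ->
  ESSE (mxf M) (mxf (fun w w' => if D w then 0 else M w w')).
Proof.
move=> MD; pose K w w' : S := if D w then 0 else (w == w')%:R.
exists (mxf M), (mxf K); rewrite !mxf_mul; split; apply: eq_mxf => w w'.
  rewrite (bigD1 w') //= /K eqxx big1 ?addr0 => [|k /negPf ->]; last by case: ifP; rewrite mulr0.
  by case: (boolP (D w')) => [/MD ->|_]; rewrite ?mul0r ?mulr1.
rewrite /K; case: ifP => _; first by rewrite big1 // => k _; rewrite mul0r.
by under eq_bigr => k _ do rewrite eq_sym; rewrite big_delta.
Qed.

End StateMoves.

Lemma ESSE_drop (S : pzSemiRingType) (K T : finType) (M : K + T -> K + T -> S) :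
  (forall w k, M w (inl k) = 0) ->
  ESSE (mxf M) (mxf (fun a b => M (inr a) (inr b))).
Proof.
move=> M0; exists (mxf (fun w b => M w (inr b))), (mxf (fun a w => (w == inr a)%:R)).
rewrite !mxf_mul; split; apply: eq_mxf => x y; last first.
  by rewrite (big_delta (inr x : K + T) (fun w => M w (inr y))).
case: y => [k|t]; first by rewrite M0 big1 // => b _; rewrite mulr0.
rewrite (bigD1 t) //= eqxx mulr1 big1 ?addr0 // => b /negPf h.
by rewrite (_ : inr t == inr b = (t == b)) // eq_sym h mulr0.
Qed.

(** * Weighted walks and first returns *)

Section Walks.
Variables (S : pzSemiRingType) (T : finType).
Implicit Types (A : T -> T -> S).

Fixpoint walk A (l : nat) (i j : T) : S :=
  if l is l'.+1 then \sum_k A i k * walk A l' k j else (i == j)%:R.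

Lemma walkD A l m i j : walk A (l + m) i j = \sum_k walk A l i k * walk A m k j.
Proof.
elim: l i => [|l IH] i /=.
  by under eq_bigr => k _ do rewrite eq_sym; rewrite big_delta.
under [RHS]eq_bigr => k _ do rewrite mulr_suml.
rewrite exchange_big; apply: eq_bigr => k _ /=; rewrite IH mulr_sumr.
by apply: eq_bigr => p _; rewrite mulrA.
Qed.

Lemma walk1 A i j : walk A 1 i j = A i j.
Proof.
rewrite /= (bigD1 j) //= eqxx mulr1 big1 ?addr0 // => k /negPf ->.
by rewrite mulr0.
Qed.

Lemma walkSr A l i j : walk A l.+1 i j = \sum_k walk A l i k * A k j.
Proof. by rewrite -addn1 walkD; apply: eq_bigr => k _; rewrite walk1. Qed.

Variables (A : T -> T -> S) (a : T).

Definition avoid (t t' : T) : S := if t' == a then 0 else A t t'.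

(* [excursion l t] weighs the walks of length [l] from [a] to [t] that do not *)
(* return to [a]; [first_return l] weighs the first returns of length [l + 1]. *)
Definition excursion (l : nat) (t : T) : S := walk avoid l a t.
Definition first_return (l : nat) : S := \sum_t excursion l t * A t a.

Lemma excursionS l t : excursion l.+1 t = \sum_k excursion l k * avoid k t.
Proof. exact: walkSr. Qed.

Lemma excursionSa l : excursion l.+1 a = 0.
Proof. by rewrite excursionS big1 // => k _; rewrite /avoid eqxx mulr0. Qed.

Lemma excursion0 t : excursion 0 t = (a == t)%:R.
Proof. by []. Qed.

(** Cut the walk at its last visit to [a], which is followed by an excursion of length [m]. *)
Lemma walk_renewal l t :
  walk A l a t = \sum_(m < l.+1) walk A (l - m) a a * excursion m t.
Proof.
elim: l t => [|l IH] t; first by rewrite big_ord1 /= eqxx mul1r.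
have e : forall t, walk A l.+1 a t =
    \sum_(m < l.+1) walk A (l - m) a a * \sum_k excursion m k * A k t.
  move=> t0; rewrite walkSr; under eq_bigr => k _ do rewrite IH mulr_suml.
  rewrite exchange_big; apply: eq_bigr => m _; rewrite mulr_sumr.
  by apply: eq_bigr => k _; rewrite mulrA.
rewrite big_ord_recl subn0 excursion0; case: (eqVneq a t) => [<-|at_].
  rewrite mulr1 big1 ?addr0 // => m _; rewrite excursionSa mulr0 //.
rewrite mulr0 add0r e; apply: eq_bigr => m _; congr (_ * _).
rewrite excursionS; apply: eq_bigr => k _; rewrite /avoid.
by rewrite eq_sym (negPf at_).
Qed.

Lemma walk_renewal_loop l :
  walk A l.+1 a a = \sum_(m < l.+1) walk A (l - m) a a * first_return m.
Proof.
rewrite walkSr; under eq_bigr => k _ do rewrite walk_renewal mulr_suml.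
rewrite exchange_big; apply: eq_bigr => m _; rewrite mulr_sumr.
by apply: eq_bigr => k _; rewrite mulrA.
Qed.

End Walks.

Section Split.
Variables (S : pzSemiRingType) (T I : finType) (A : T -> T -> S) (a : T) (r : nat).
Variables (F : I -> nat -> S) (Z : I -> T -> S).
Local Notation W := ((option I * 'I_r) + T)%type.
Local Notation f := (first_return A a).
Local Notation ex := (excursion A a).

Definition onT (v : T -> S) (w : W) : S := if w is inr t then v t else 0.
Definition at_chain (i : option I) (l : nat) (w : W) : S :=
  if w is inl (i', l') then ((i' == i) && (l' == l :> nat))%:R else 0.
Definition at_some (l : nat) (w : W) : S :=
  if w is inl (Some _, l') then (l' == l :> nat)%:R else 0.

(* The state [(None, l)] means that [a] was last visited [l] steps ago; the     *)
(* chains [(Some i, l)] carry the parts into which its future is split. [nu l]  *)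
(* says how the position after [l] steps is represented.                        *)
Definition chain_graph (nu : nat -> W -> S) (w w' : W) : S :=
  match w with
  | inl (None, l) => f l * nu 0%N w' + nu l.+1 w'
  | inl (Some i, l) => F i l * nu 0%N w' +
      (if (l.+1 < r)%N then at_chain (Some i) l.+1 w' else onT (Z i) w')
  | inr t => A t a * nu 0%N w' + onT (avoid A a t) w'
  end.

(** A visit to [a] now starts all chains [Some i] at once. The states [(None, l)] remain, but no
    edge enters them. *)
Definition split_graph : W -> W -> S :=
  chain_graph (fun l => if (l < r)%N then at_some l else onT (ex r)).

Lemma chain_graph_redirect (nu nu' : nat -> W -> S) (j : 'I_r) (vec : W -> S) :
  (forall l, (l <= r)%N -> redirect (inl (None, j)) vec (nu l) =1 nu' l) ->
  vec (inl (None, j)) = 0 ->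
  (forall w', f j * nu 0%N w' + nu j.+1 w' = \sum_w vec w * chain_graph nu w w') ->
  ESSE (mxf (chain_graph nu)) (mxf (chain_graph nu')).
Proof.
move=> hnu v0 hrow.
suff <- : mxf (fun w => redirect (inl (None, j)) vec (chain_graph nu w)) = mxf (chain_graph nu').
  exact: ESSE_redirect.
apply: eq_mxf => w w'; case: w => [[[i|] l]|t] /=.
- rewrite redirect_linear hnu // redirect_id //.
  by case: ifP.
- by rewrite redirect_linear !hnu.
- by rewrite redirect_linear hnu // redirect_id.
Qed.

Hypothesis F_sum : forall l, (l < r)%N -> \sum_i F i l = f l.
Hypothesis Z_sum : forall t, \sum_i Z i t = ex r t.

(** Attach the chains to A as unreachable states ([nu1 0]). Replace the excursion of length j by the
    state [(None, j)], whose row is the matching combination of rows, for each j in turn; this leads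
    to [nu1 r], which agrees with [nu2 r]. Then replace each [(None, j)] by the states
    [(Some i, j)], whose rows add up to its row by [F_sum] and [Z_sum]; this leads to [nu2 0], the
    split graph. *)
Lemma split_graph_SSE : SSE (mxf A) (mxf split_graph).
Proof.
pose nu1 j l := if (l < j)%N then at_chain None l else onT (ex l).
pose nu2 j l := if (l < j)%N then at_chain None l else if (l < r)%N then at_some l else onT (ex r).
have step1 j : (j < r)%N -> ESSE (mxf (chain_graph (nu1 j.+1))) (mxf (chain_graph (nu1 j))).
  move=> jr; apply: (@chain_graph_redirect _ _ (Ordinal jr) (onT (ex j))) => //.
    move=> l lr w'; rewrite /nu1 ltnS leq_eqVlt; case: (eqVneq l j) => [->|lj] /=.
      rewrite ltnn /redirect /= eqxx mul1r; case: eqP => [->|]; first by rewrite addr0.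
      case: w' => [[[i|] l']|t] //=; rewrite ?addr0 // => h.
      by case: eqP => [e|]; rewrite ?addr0 //; case: h; congr (inl (None, _)); apply: val_inj.
    by rewrite redirect_id //; case: ifP => //= _; rewrite eq_sym (negPf lj).
  move=> w'; rewrite big_sumType /= [X in _ = X + _]big1 ?add0r => [|k _]; last by rewrite mul0r.
  under eq_bigr => t _ do rewrite mulrDr mulrA.
  rewrite big_split -mulr_suml; congr (_ + _).
  rewrite /nu1 ltnn; case: w' => [k|t] /=; first by rewrite big1 // => k' _; rewrite mulr0.
  exact: excursionS.
have step2 j : (j < r)%N -> ESSE (mxf (chain_graph (nu2 j.+1))) (mxf (chain_graph (nu2 j))).
  move=> jr; apply: (@chain_graph_redirect _ _ (Ordinal jr) (at_some j)) => //.
    move=> l lr w'; rewrite /nu2 ltnS leq_eqVlt; case: (eqVneq l j) => [->|lj] /=.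
      rewrite ltnn jr /redirect /= eqxx mul1r; case: eqP => [->|]; first by rewrite addr0.
      case: w' => [[[i|] l']|t] //=; rewrite ?addr0 // => h.
      by rewrite add0r; case: eqP => // e; case: h; congr (inl (None, _)); apply: val_inj.
    rewrite redirect_id //; case: ifP => //= _; first by rewrite eq_sym (negPf lj).
    by case: ifP.
  move=> w'; rewrite big_sumType /= [X in _ = _ + X]big1 ?addr0 => [|t _]; last by rewrite mul0r.
  transitivity (\sum_i \sum_l at_some j (inl (i, l)) * chain_graph (nu2 j.+1) (inl (i, l)) w');
    last by rewrite pair_bigA; apply: eq_bigr => -[].
  rewrite (bigD1 None) //= big1 ?add0r => [|l _]; last by rewrite mul0r.
  rewrite (reindex_omap Some id) /=; last by case.
  rewrite (eq_bigr (fun i => F i j * nu2 j.+1 0%N w' +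
     (if (j.+1 < r)%N then at_chain (Some i) j.+1 w' else onT (Z i) w'))) => [|i _]; last first.
    rewrite (bigD1 (Ordinal jr)) //= eqxx mul1r big1 ?addr0 // => l.
    by rewrite -val_eqE /= => /negPf ->; rewrite mul0r.
  rewrite (eq_bigl xpredT) => [|i]; last by rewrite eqxx.
  rewrite big_split -mulr_suml F_sum //; congr (_ + _).
  rewrite /nu2 ltnn; case: ifP => _.
    case: w' => [[[i|] l']|t] /=; try by rewrite big1 // => i _; rewrite ?andbF.
    rewrite (bigD1 i) //= eqxx big1 ?addr0 // => k /negPf h.
    by rewrite (_ : Some i == Some k = (i == k)) // eq_sym h.
  by case: w' => [k|t] /=; rewrite ?Z_sum // big1.
have st1 j : (j <= r)%N -> SSE (mxf (chain_graph (nu1 0%N))) (mxf (chain_graph (nu1 j))).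
  elim: j => [|j IH] jr; first exact: SSE_refl.
  apply: SSE_trans (IH (ltnW jr)) _; apply: SSE_sym; exact/SSE_step/step1.
have st2 j : (j <= r)%N -> SSE (mxf (chain_graph (nu2 0%N))) (mxf (chain_graph (nu2 j))).
  elim: j => [|j IH] jr; first exact: SSE_refl.
  apply: SSE_trans (IH (ltnW jr)) _; apply: SSE_sym; exact/SSE_step/step2.
have e12 : mxf (chain_graph (nu2 r)) = mxf (chain_graph (nu1 r)).
  have h l : (l <= r)%N -> nu2 r l = nu1 r l.
    by rewrite /nu1 /nu2; case: ltngtP => // ->.
  by apply: eq_mxf => w w'; case: w => [[[i|] l]|t] /=; rewrite !h.
apply: SSE_trans (SSE_sym (st2 r (leqnn r))); rewrite e12.
apply: SSE_trans (st1 r (leqnn r)); apply: SSE_sym.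
(* Under [nu1 0] no edge from [T] enters a chain, and a chain state is entered at most from the
   level before it. So the chains are erased from level 0 upwards and then dropped. *)
pose D j (w : W) := if w is inl (_, l) then (l < j)%N else false.
pose G j w w' := if D j w then 0 else chain_graph (nu1 0%N) w w'.
have dead j : (j <= r)%N -> SSE (mxf (chain_graph (nu1 0%N))) (mxf (G j)).
  elim: j => [|j IH] jr.
    by rewrite (_ : mxf (G 0%N) = mxf (chain_graph (nu1 0%N))); [exact: SSE_refl|apply: eq_mxf => -[[i l]|t]].
  apply: SSE_trans (IH (ltnW jr)) _; apply: SSE_step.
  rewrite (_ : mxf (G j.+1) = mxf (fun w w' => if D j.+1 w then 0 else G j w w')).
    apply: ESSE_zero_rows => w [[i' l']|//] /= hl'; rewrite /G; case: ifP => //.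
    case: w => [[[i|] l]|t] /= hl; rewrite /nu1 /= !mulr0 ?addr0 ?add0r //.
    case: ifP => // _; rewrite (_ : (l' == l.+1 :> nat) = false) ?andbF //.
    by apply/eqP; lia.
  apply: eq_mxf => -[[i l]|t] w' //=; rewrite /G /=.
  by case: ltnP => // h; rewrite ifN // -leqNgt ltnW.
apply: SSE_trans (dead r (leqnn r)) _; apply: SSE_step.
rewrite (_ : mxf A = mxf (fun t t' => G r (inr t) (inr t'))).
  apply: ESSE_drop => -[[i l]|t] [i' l']; rewrite /G /= ?ltn_ord //.
  by rewrite /nu1 /= mulr0 addr0.
apply: eq_mxf => t t'; rewrite /G /= /nu1 /= /avoid.
case: (eqVneq t' a) => [->|h]; first by rewrite excursion0 eqxx mulr1 addr0.
by rewrite excursion0 eq_sym (negPf h) mulr0 add0r.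
Qed.
End Split.

Lemma big_option (S : nmodType) (T : finType) (F : option T -> S) :
  \sum_o F o = F None + \sum_t F (Some t).
Proof.
rewrite (bigD1 None) //=; congr (_ + _).
rewrite (reindex_omap Some id) /=; last by case.
by apply: eq_bigl => i; rewrite eqxx.
Qed.

(** * Positive matrices over Z_+G *)

Section Positivity.
Variable gT : finGroupType.
Local Notation S := (ZpG gT).
Implicit Types x y : S.

Definition gle x y := forall g : gT, (x g <= y g)%N.
Definition ample (c : nat) x := forall g : gT, (c <= x g)%N.

Lemma gle_refl x : gle x x. Proof. by move=> g. Qed.

Lemma gle_trans x y z : gle x y -> gle y z -> gle x z.
Proof. by move=> h1 h2 g; apply: leq_trans (h1 g) (h2 g). Qed.

Lemma gle_mul x x' y y' : gle x x' -> gle y y' -> gle (x * y) (x' * y').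
Proof. by move=> hx hy g; rewrite !ffunE; apply: leq_sum => h _; apply: leq_mul. Qed.

Lemma sumZpGE (I : finType) (P : pred I) (F : I -> S) g :
  (\sum_(i | P i) F i) g = (\sum_(i | P i) F i g)%N.
Proof. by elim/big_rec2: _ => [|i x y _ <-]; rewrite !ffunE. Qed.

Lemma gle_sum (I : finType) (F G : I -> S) :
  (forall i, gle (F i) (G i)) -> gle (\sum_i F i) (\sum_i G i).
Proof. by move=> h g; rewrite !sumZpGE; apply: leq_sum => i _; apply: h. Qed.

Lemma gle_sum_inj (I J : finType) (h : I -> J) (F : J -> S) : injective h ->
  gle (\sum_i F (h i)) (\sum_j F j).
Proof.
move=> hinj g; rewrite !sumZpGE (bigID (mem (h @: [set: I]%SET))) /=.
rewrite big_imset /=; last by move=> i j _ _; apply: hinj.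
by rewrite [X in (_ <= X + _)%N](eq_bigl xpredT) ?leq_addr // => i; rewrite inE.
Qed.

Lemma gle_sum1 (I : finType) (F : I -> S) i : gle (F i) (\sum_j F j).
Proof. by move=> g; rewrite sumZpGE (bigD1 i) //= leq_addr. Qed.

Lemma ZpG_neq0P x : reflect (exists g, (0 < x g)%N) (x != 0).
Proof.
apply: (iffP idP) => [h|[g hg]]; last by apply: contraTneq hg => ->; rewrite ffunE.
apply: contrapT => hn; move/eqP: h; apply; apply/ffunP=> g; rewrite ffunE.
by apply/eqP; rewrite -leqn0 leqNgt; apply/negP => hg; apply: hn; exists g.
Qed.

Lemma gle_neq0 x y : gle x y -> x != 0 -> y != 0.
Proof.
move=> h /ZpG_neq0P[g hg]; apply/ZpG_neq0P; exists g; exact: leq_trans hg (h g).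
Qed.

Lemma mul_neq0 x y : x != 0 -> y != 0 -> x * y != 0.
Proof.
move=> /ZpG_neq0P[g hg] /ZpG_neq0P[h hh]; apply/ZpG_neq0P; exists (g * h)%g.
by rewrite ffunE (bigD1 g) //= mulKg ltn_addr // muln_gt0 hg hh.
Qed.

Lemma sum_neq0 (I : finType) (F : I -> S) i : F i != 0 -> \sum_j F j != 0.
Proof. exact: gle_neq0 (gle_sum1 F i). Qed.

Lemma sum_neq0_ex (I : finType) (F : I -> S) : \sum_j F j != 0 -> exists i, F i != 0.
Proof.
move=> h; apply: contrapT => hn; move/eqP: h; apply; apply: big1 => i _.
by apply/eqP; apply: contrapT => hi; apply: hn; exists i; apply/negP.
Qed.

Lemma factor_neq0 x y : x * y != 0 -> x != 0 /\ y != 0.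
Proof.
by move=> h; split; apply: contraNneq h => ->; rewrite ?mul0r ?mulr0.
Qed.

Lemma ample_gle c x y : ample c x -> gle x y -> ample c y.
Proof. by move=> hx h g; apply: leq_trans (hx g) (h g). Qed.

Lemma ampleW c d x : (c <= d)%N -> ample d x -> ample c x.
Proof. by move=> h hx g; apply: leq_trans h (hx g). Qed.

Lemma ample_neq0 c x : ample c.+1 x -> x != 0.
Proof. by move=> h; apply/ZpG_neq0P; exists 1%g; apply: leq_trans (h _). Qed.

Lemma ample_mulr c x y : ample c x -> y != 0 -> ample c (x * y).
Proof.
move=> hx /ZpG_neq0P[h hh] g; rewrite ffunE (bigD1 (g * h^-1)%g) //=.
rewrite invMg invgK -mulgA mulVg mulg1; apply: leq_trans (leq_addr _ _).
by rewrite -[c]muln1 leq_mul.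
Qed.

Lemma ample_mull c x y : x != 0 -> ample c y -> ample c (x * y).
Proof.
move=> /ZpG_neq0P[h hh] hy g; rewrite ffunE (bigD1 h) //=.
by apply: leq_trans (leq_addr _ _); rewrite -[c]mul1n leq_mul.
Qed.

Lemma ample_mul c d x y : ample c x -> ample d y -> ample (c * d) (x * y).
Proof.
move=> hx hy g; rewrite ffunE (bigD1 1%g) //=.
by apply: leq_trans (leq_addr _ _); rewrite leq_mul.
Qed.

Variable T : finType.
Implicit Types A : T -> T -> S.

Lemma gle_walk A l m i k j : gle (walk A l i k * walk A m k j) (walk A (l + m) i j).
Proof. by rewrite walkD; apply: (gle_sum1 (fun k => walk A l i k * walk A m k j)). Qed.

Lemma walk_neq0D A l m i k j : walk A l i k != 0 -> walk A m k j != 0 ->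
  walk A (l + m) i j != 0.
Proof. by move=> h1 h2; apply: gle_neq0 (gle_walk _ _ _ _ _ _) (mul_neq0 h1 h2). Qed.

(** Every length above [p] is a sum of lengths between p and 2p, so this window suffices; the marked
    graph will only guarantee short loops. Concatenating [q.+1] loops multiplies the bounds to
    [2 ^ q.+1]. *)
Lemma ample_loops_growth A i p L : (0 < p)%N ->
  (forall l, (p <= l <= p.*2)%N -> ample 2 (walk A l i i)) ->
  exists l0, forall l, (l0 <= l)%N -> ample L (walk A l i i).
Proof.
move=> p0 hp.
have h2 l : (p <= l)%N -> ample 2 (walk A l i i).
  elim/ltn_ind: l => l IH pl; have [lp|lp] := leqP l p.*2; first by apply: hp; rewrite pl.
  rewrite -(subnKC pl); apply: ample_gle (gle_walk A _ _ i i i).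
  apply: (@ampleW 2 (2 * 2)) => //; apply: ample_mul; first by apply: hp; rewrite leqnn -addnn leq_addr.
  by apply: IH; lia.
have hq q l : (p * q.+1 <= l)%N -> ample (2 ^ q.+1) (walk A l i i).
  elim: q l => [|q IH] l; first by rewrite muln1; apply: h2.
  rewrite mulnS => pl; have pl' : (p <= l)%N by apply: leq_trans pl; apply: leq_addr.
  rewrite -(subnKC pl') expnS; apply: ample_gle (gle_walk A _ _ i i i).
  apply: ample_mul; first exact: h2.
  by apply: IH; rewrite leq_subRL.
exists (p * L.+1)%N => l /hq; apply: ampleW.
by apply: leq_trans (leqnSn L) (ltnW (ltn_expl _ _)).
Qed.

End Positivity.

(* The row of [a] is distributed over [Some a] and the new state [None]. *)
Section OutSplit.
Variables (gT : finGroupType) (T : finType).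
Local Notation S := (ZpG gT).
Variables (A : T -> T -> S) (a : T) (rho0 rho1 : T -> S).
Hypothesis rho : forall t, A a t = rho0 t + rho1 t.

Definition out_row (o : option T) (t : T) : S :=
  if o is Some s then (if s == a then rho0 t else A s t) else rho1 t.
Definition out_split (o o' : option T) : S :=
  if o' is Some t then out_row o t else out_row o a.

Lemma out_split_ESSE : ESSE (mxf A) (mxf out_split).
Proof.
pose D (t : T) (o : option T) : S := if o is Some s then (t == s)%:R else (t == a)%:R.
exists (mxf D), (mxf out_row); rewrite !mxf_mul; split; apply: eq_mxf.
  move=> t t'; rewrite big_option /=.
  under eq_bigr => k _ do rewrite eq_sym; rewrite big_delta.
  by case: eqP => [->|_]; rewrite ?mul0r ?add0r // mul1r rho addrC.
move=> o o'; have h s : \sum_b out_row o b * (b == s)%:R = out_row o s.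
  rewrite (bigD1 s) //= eqxx mulr1 big1 ?addr0 // => k /negPf ->; by rewrite mulr0.
by case: o' => [s|] /=; rewrite h.
Qed.

(** The copies [Some a] and [None] of [a] receive the same edges and their rows add up to the row of
    [a], so after its first step a walk to [None] is weighed as a walk of A to [a]. *)
Lemma walk_out_split l o :
  walk out_split l.+1 o None = \sum_t out_row o t * walk A l t a.
Proof.
elim: l o => [|l IH] o.
  by rewrite walk1 /= (bigD1 a) //= eqxx mulr1 big1 ?addr0 // => k /negPf ->; rewrite mulr0.
have -> : walk out_split l.+2 o None = \sum_k out_split o k * walk out_split l.+1 k None by [].
rewrite big_option IH; under [X in _ + X]eq_bigr => t _ do rewrite IH.
have -> : \sum_t out_row o t * walk A l.+1 t a =
   \sum_t out_row o t * \sum_k A t k * walk A l k a by [].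
rewrite [X in _ + X = _](bigD1 a) //= [in RHS](bigD1 a) //= addrA; congr (_ + _); last first.
  by apply: eq_bigr => s /negPf ->.
rewrite -mulrDr -big_split; congr (_ * _); apply: eq_bigr => t _.
by rewrite eqxx rho mulrDl addrC.
Qed.

Local Notation thin := (fun s => out_row (Some s)).

(** A walk that avoids [None] sees only the part [rho0] of the row of [a]. *)
Lemma excursion_out_split l t :
  excursion out_split None l.+1 (Some t) = \sum_s rho1 s * walk thin l s t.
Proof.
elim: l t => [|l IH] t; rewrite excursionS big_option.
  rewrite excursion0 eqxx mul1r big1 ?addr0 => [|s _]; last by rewrite excursion0 mul0r.
  rewrite /avoid /= (bigD1 t) //= eqxx mulr1 big1 ?addr0 // => k /negPf ->; by rewrite mulr0.
rewrite excursionSa mul0r add0r.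
under eq_bigr => s _ do rewrite IH mulr_suml.
rewrite exchange_big; apply: eq_bigr => s _; rewrite walkSr mulr_sumr.
by apply: eq_bigr => k _; rewrite mulrA.
Qed.

Lemma first_return_out_split l :
  first_return out_split None l.+1 = \sum_s rho1 s * walk thin l.+1 s a.
Proof.
rewrite /first_return big_option excursionSa mul0r add0r.
under eq_bigr => s _ do rewrite excursion_out_split mulr_suml.
rewrite exchange_big; apply: eq_bigr => s _; rewrite walkSr mulr_sumr.
by apply: eq_bigr => k _; rewrite mulrA.
Qed.

Hypothesis rho0_neq0 : exists t, rho0 t != 0.
Hypothesis rho1_neq0 : exists t, rho1 t != 0.
Hypothesis reach : forall t, exists2 j, (0 < j)%N & walk A j t a != 0.

(** Up to its first visit to [a], a walk starting elsewhere uses only unchanged rows; a walk from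
    [a] can start with a step of [rho0]. *)
Lemma thin_reach t : exists2 j, (0 < j)%N & walk thin j t a != 0.
Proof.
have h : forall j t, t != a -> walk A j t a != 0 -> exists2 j, (0 < j)%N & walk thin j t a != 0.
  elim=> [|j IH] {}t ta /=; first by rewrite (negPf ta) eqxx.
  case/sum_neq0_ex=> s /factor_neq0[h1 h2].
  have ts : walk thin 1 t s != 0 by rewrite walk1 /= (negPf ta).
  have [sa|sa] := eqVneq s a; first by exists 1%N => //; rewrite -sa.
  have [j' j0 hj'] := IH s sa h2; exists (1 + j')%N => //; exact: walk_neq0D ts hj'.
have [ta|ta] := eqVneq t a; last by have [j _ hj] := reach t; apply: h hj.
have [s hs] := rho0_neq0; have ts : walk thin 1 t s != 0 by rewrite walk1 /= ta eqxx.
have [sa|sa] := eqVneq s a; first by exists 1%N => //; rewrite -sa.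
have [j _ hj] := reach s; have [j' _ hj'] := h j s sa hj.
exists (1 + j')%N => //; exact: walk_neq0D ts hj'.
Qed.

(** Since [rho0] is nonzero, a walk can return to [Some a] any number of times without meeting
    [None]; entering by [rho1] and leaving through the column of [a] makes it a first return of
    [None]. *)
Lemma first_return_out_split_infinite N :
  exists2 l, (N <= l)%N & first_return out_split None l != 0.
Proof.
have h t : exists2 j, (N < j)%N & walk thin j t a != 0.
  elim: N t => [|M IH] t; first exact: thin_reach.
  have [j hj w1] := IH t; have [j' hj' w2] := thin_reach a.
  exists (j + j')%N; last exact: walk_neq0D w1 w2.
  by rewrite -addn1 leq_add.
have [s hs] := rho1_neq0; have [[|j] // hj w] := h s.
exists j.+1; first exact: ltnW.
rewrite first_return_out_split; apply: (sum_neq0 (i := s)); exact: mul_neq0.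
Qed.
End OutSplit.

(* The state [marker] starts a chain that runs through one single first-return  *)
(* loop of [a], of length [q + 1] and label [g]; [unmarked 0] starts the rest.   *)
Section Marker.
Variables (gT : finGroupType) (T : finType).
Local Notation S := (ZpG gT).
Variables (A : T -> T -> S) (a : T) (q : nat) (g : gT).
Hypothesis fq : (0 < first_return A a q g)%N.

Local Notation f := (first_return A a).
Definition loop : S := [ffun h => nat_of_bool (h == g)].
Definition rest : S := [ffun h => (f q h - loop h)%N].
Definition loop_part (i : bool) (l : nat) : S :=
  if l == q then (if i then loop else rest) else (if i then 0 else f l).
Definition exit_part (i : bool) (t : T) : S := if i then 0 else excursion A a q.+1 t.

Lemma loopK : loop + rest = f q.
Proof.
apply/ffunP=> h; rewrite !ffunE; case: eqP => [->|_]; first exact: subnKC.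
by rewrite subn0; apply: add0n.
Qed.

Local Notation W := ((option bool * 'I_q.+1) + T)%type.
Definition marked : W -> W -> S := split_graph A a loop_part exit_part.
Definition marker : W := inl (Some true, ord0).
Definition unmarked (m : nat) : W := inl (Some false, inord m).

Lemma marked_SSE : SSE (mxf A) (mxf marked).
Proof.
apply: split_graph_SSE => [l lq|t]; rewrite (bigD1 true) //= (bigD1 false) //= big1 ?addr0;
  try by case.
  by rewrite /loop_part; case: eqP => [->|_]; rewrite ?loopK // add0r.
by rewrite add0r.
Qed.

Lemma marked_return i l j : marked (inl (Some i, l)) (inl (Some j, ord0)) = loop_part i l.
Proof.
rewrite /marked /split_graph /= mulr1; case: ifP => _; last by rewrite addr0.
by rewrite andbF addr0.
Qed.

Lemma marked_step i (l l' : 'I_q.+1) : val l' = l.+1 ->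
  marked (inl (Some i, l)) (inl (Some i, l')) = 1.
Proof.
move=> e; rewrite /marked /split_graph /= e mulr0 add0r -e ltn_ord /=.
by rewrite !eqxx.
Qed.

Lemma loop_neq0 : loop != 0.
Proof. by apply/ZpG_neq0P; exists g; rewrite ffunE eqxx. Qed.

Local Notation M := (avoid marked marker).

Lemma avoid_unmarked w m : M w (unmarked m) = marked w (unmarked m).
Proof. by []. Qed.

Lemma unmarked0 : unmarked 0 = inl (Some false, ord0).
Proof. by congr (inl (_, _)); apply: val_inj; rewrite /= inordK. Qed.

(** The unmarked chain keeps every first return of index below [q], so loops of A of length at most
    [q] can be followed there without meeting the marker. The remaining [m] steps run down that
    chain from the last visit to [a]. *)
Lemma marked_excursion l m : (l <= q)%N -> (m <= l)%N ->
  gle (walk A (l - m) a a) (walk M l (unmarked 0) (unmarked m)).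
Proof.
elim: l m => [|l IH] m lq.
  by rewrite leqn0 => /eqP ->; rewrite /= !eqxx; apply: gle_refl.
case: m => [_|m ml]; last first.
  rewrite subSS; apply: gle_trans (IH m (ltnW lq) ml) _.
  rewrite walkSr; apply: gle_trans (gle_sum1 _ (unmarked m)).
  rewrite avoid_unmarked (_ : marked _ _ = 1) ?mulr1; first exact: gle_refl.
  by apply: marked_step; rewrite /= !inordK; lia.
rewrite subn0 walk_renewal_loop walkSr.
have linj : injective (fun m : 'I_l.+1 => unmarked m).
  move=> i j [] /(congr1 val) /=; rewrite !inordK => [e||]; first exact: val_inj.
    exact: leq_trans (ltn_ord j) (leqW lq).
  exact: leq_trans (ltn_ord i) (leqW lq).
apply: gle_trans (gle_sum_inj _ linj); apply: gle_sum => m; apply: gle_mul.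
  by apply: IH; [exact: ltnW|rewrite -ltnS].
rewrite avoid_unmarked unmarked0 /unmarked marked_return /loop_part inordK; last first.
  exact: leq_trans (ltn_ord m) (leqW lq).
rewrite ltn_eqF; first exact: gle_refl.
exact: leq_trans (ltn_ord m) lq.
Qed.

Lemma walk_marker m : (m <= q)%N -> walk M m marker (inl (Some true, inord m)) != 0.
Proof.
elim: m => [_|m IH mq].
  rewrite (_ : inord 0 = ord0); last by apply: val_inj; rewrite /= inordK.
  by rewrite [walk _ _ _ _](_ : _ = 1) ?oner_neq0 //= /marker eqxx.
rewrite walkSr; apply: (sum_neq0 (i := inl (Some true, inord m))).
apply: mul_neq0; first by apply: IH; apply: ltnW.
rewrite /avoid ifF; last first.
  by apply/eqP => -[] /(congr1 val) /=; rewrite inordK.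
rewrite (_ : marked _ _ = 1) ?oner_neq0 //; apply: marked_step; rewrite /= !inordK; lia.
Qed.

Lemma walk_marker_unmarked : walk M q.+1 marker (unmarked 0) != 0.
Proof.
rewrite walkSr; apply: (sum_neq0 (i := inl (Some true, inord q))).
apply: mul_neq0; first exact: walk_marker.
rewrite avoid_unmarked unmarked0 marked_return /loop_part inordK // eqxx.
exact: loop_neq0.
Qed.

(** A long first return of the marker: [q.+1] steps through the marked loop to [unmarked 0], then
    loops there that avoid the marker, then [m] steps down the unmarked chain, and a closing edge of
    weight [f m]. Since 2p < q, all loop lengths from p to 2p are available, and the middle part
    grows without bound. *)
Lemma first_return_marker p : (0 < p)%N -> (p.*2 < q)%N ->
  (forall l, (p <= l)%N -> ample 2 (walk A l a a)) ->
  forall L, exists l0, forall l, (l0 <= l)%N -> ample L (first_return marked marker l).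
Proof.
move=> p0 pq hp L.
have [|l0 hl0] := @ample_loops_growth gT _ M (unmarked 0) p L p0.
  move=> l /andP[pl lp]; apply: ample_gle (hp l pl) _.
  rewrite -[in walk A l _ _](subn0 l); apply: marked_excursion => //.
  by apply: leq_trans lp (ltnW pq).
have [m mp fm] : exists2 m, (m < p)%N & f m != 0.
  have : walk A p a a != 0 by apply: ample_neq0 (hp p (leqnn p)).
  case: (p) p0 => // p' _; rewrite walk_renewal_loop => /sum_neq0_ex[m /factor_neq0[_ h]].
  by exists m.
have mq : (m < q)%N by apply: leq_trans mp _; rewrite -addnn in pq; lia.
have wm : walk M m (unmarked 0) (unmarked m) != 0.
  have := @marked_excursion m m (ltnW mq) (leqnn m); rewrite subnn => /gle_neq0; apply.
  by rewrite /= eqxx oner_neq0.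
exists (q.+1 + l0 + m)%N => l hl; rewrite /first_return.
apply: ample_gle (gle_sum1 _ (unmarked m)).
apply: ample_mulr; last first.
  rewrite marked_return /loop_part inordK ?ltn_eqF //.
  exact: leq_trans mq (leqnSn _).
rewrite /excursion (_ : l = (q.+1 + ((l - q.+1 - m) + m))%N); last by lia.
apply: ample_gle (gle_walk _ _ _ _ (unmarked 0) _).
apply: ample_mull; first exact: walk_marker_unmarked.
apply: ample_gle (gle_walk _ _ _ _ (unmarked 0) _).
by apply: ample_mulr => //; apply: hl0; lia.
Qed.
End Marker.

Section Preparation.
Variable gT : finGroupType.
Local Notation S := (ZpG gT).

Lemma marked_presentation (T : finType) (A : T -> T -> S) (a : T) p :
  (0 < p)%N -> (forall l, (p <= l)%N -> ample 2 (walk A l a a)) ->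
  (forall N, exists2 l, (N <= l)%N & first_return A a l != 0) ->
  exists (T' : finType) (A' : T' -> T' -> S) (x : T'), SSE (mxf A) (mxf A') /\
    forall L, exists l0, forall l, (l0 <= l)%N -> ample L (first_return A' x l).
Proof.
move=> p0 hp hinf; have [q pq /ZpG_neq0P[g hg]] := hinf p.*2.+1.
exists _, (@marked _ _ A a q g), (@marker _ q); split; first exact: marked_SSE hg.
exact: (first_return_marker hg p0 pq hp).
Qed.
End Preparation.

Lemma ESSE_mxf (S : pzSemiRingType) n (A : 'M[S]_n) :
  ESSE A (mxf (fun i j : 'I_n => A i j)).
Proof.
exists (\matrix_(i, j) A i (enum_val j)), (\matrix_(i, j) (enum_val i == j)%:R).
split; apply/matrixP=> i j; rewrite !mxE.
  under eq_bigr => k _ do rewrite !mxE.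
  rewrite (sum_enum_val (fun k => A i k * (k == j)%:R)) (bigD1 j) //= eqxx mulr1.
  by rewrite big1 ?addr0 // => k /negPf ->; rewrite mulr0.
under eq_bigr => k _ do rewrite !mxE eq_sym.
by rewrite (big_delta (enum_val i) (fun k => A k (enum_val j))).
Qed.

(** * Presentations of a primitive matrix with large first returns *)

Section FromPrimitive.
Variables (gT : finGroupType) (n : nat) (A : 'M[ZpG gT]_n).
Local Notation S := (ZpG gT).
Local Notation B := (fun i j : 'I_n => A i j).

Lemma walk_exp l i j : walk B l i j = (A ^+ l) i j.
Proof.
elim: l i => [|l IH] i /=; first by rewrite expr0 mxE.
by rewrite exprS -mulmxE mxE; apply: eq_bigr => k _; rewrite IH.
Qed.

(** Otherwise all row sums are at most 1, and a left eigenvector [v] for [z] gives |z| sum |v_j| <=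
    sum |v_i|, so |z| <= 1. *)
Lemma spectral_radius_row (lambda : algC) :
  is_spectral_radius (map_mx (@ZG_of gT) A) lambda -> 1 < lambda ->
  exists a, (1 < \sum_t augmentation (A a t))%N.
Proof.
case=> -[z /eigenvalueP[v vA v0] zl] _ l1; apply: contrapT => hn.
have hrow a : (\sum_t augmentation (A a t) <= 1)%N.
  by rewrite leqNgt; apply/negP => h; apply: hn; exists a.
have : \sum_j `|v 0 j| * `|z| <= \sum_i `|v 0 i|.
  have -> : \sum_j `|v 0 j| * `|z| = \sum_j `|\sum_i v 0 i * (augmentation (A i j))%:R|.
    apply: eq_bigr => j _; rewrite -normrM mulrC.
    have := congr1 (fun M : 'rV_n => M 0 j) vA; rewrite !mxE => <-.
    congr `|_|; apply: eq_bigr => i _; rewrite !mxE augmentation_ZG_of.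
    by rewrite pmulrn.
  apply: le_trans (_ : \sum_j \sum_i `|v 0 i| * (augmentation (A i j))%:R <= _).
    apply: ler_sum => j _; apply: le_trans (ler_norm_sum _ _ _) _.
    by apply: ler_sum => i _; rewrite normrM normr_nat.
  rewrite exchange_big; apply: ler_sum => i _; rewrite -mulr_sumr -natr_sum.
  by rewrite ler_piMr // lern1.
rewrite -mulr_suml zl.
have s0 : 0 < \sum_i `|v 0 i|.
  have /rV0Pn[j vj] := v0.
  rewrite (bigD1 j) //= ltr_pwDl ?normr_gt0 //; exact: sumr_ge0.
by rewrite ger_pMr // => /(lt_le_trans l1); rewrite ltxx.
Qed.

(** [rho1] is one group element occurring in the row; a total weight above 1 leaves a nonzero
    remainder [rho0]. *)
Lemma split_unit (a : 'I_n) : (1 < \sum_t augmentation (A a t))%N ->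
  exists (rho0 rho1 : 'I_n -> S), [/\ forall t, A a t = rho0 t + rho1 t,
    exists t, rho0 t != 0 & exists t, rho1 t != 0].
Proof.
move=> h1.
have [t0 /ZpG_neq0P[g hg]] : exists t, A a t != 0.
  apply: contrapT => hn; move: h1; rewrite big1 // => t _.
  suff -> : A a t = 0 by rewrite raddf0.
  by apply/eqP; apply: contrapT => ht; apply: hn; exists t; apply/negP.
pose u : S := [ffun h => nat_of_bool (h == g)].
pose rho1 t : S := if t == t0 then u else 0.
pose rho0 t : S := if t == t0 then [ffun h => (A a t h - u h)%N] else A a t.
have rho t : A a t = rho0 t + rho1 t.
  rewrite /rho0 /rho1; case: (eqVneq t t0) => [->|_]; last by rewrite addr0.
  apply/ffunP=> h; rewrite !ffunE; case: eqP => [->|_]; first by rewrite [LHS](esym (subnK hg)).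
  by rewrite subn0; symmetry; apply: addn0.
exists rho0, rho1; split=> //; last first.
  by exists t0; rewrite /rho1 eqxx; apply/ZpG_neq0P; exists g; rewrite ffunE eqxx.
apply: contrapT => hn; move: h1; rewrite ltnNge => /negP; apply.
have r0 t : rho0 t = 0 by apply/eqP; apply: contrapT => ht; apply: hn; exists t; apply/negP.
rewrite (eq_bigr (fun t => augmentation (rho1 t))) => [|t _]; last by rewrite rho r0 add0r.
rewrite (bigD1 t0) //= big1 => [|t /negPf ht]; last by rewrite /rho1 ht raddf0.
rewrite /rho1 eqxx addn0 /augmentation (bigD1 g) //= big1 ?ffunE ?eqxx // => h /negPf hh.
by rewrite ffunE hh.
Qed.

Lemma primitive_presentation (lambda : algC) : G_primitive A ->
  is_spectral_radius (map_mx (@ZG_of gT) A) lambda -> 1 < lambda ->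
  exists (T : finType) (A' : T -> T -> S) (x : T), SSE A (mxf A') /\
    forall L, exists l0, forall l, (l0 <= l)%N -> ample L (first_return A' x l).
Proof.
move=> [k k0 hk] hsr l1; have [a ha] := spectral_radius_row hsr l1.
have hk1 i j : ample 1 (walk B k i j) by move=> g; rewrite walk_exp.
have row0 i : exists s, A i s != 0.
  have := ample_neq0 (hk1 i i); case: (k) k0 => // k' _ /sum_neq0_ex[s /factor_neq0[h _]].
  by exists s.
have hk2 l : (k <= l)%N -> forall i j, ample 1 (walk B l i j).
  move=> kl; rewrite -(subnK kl); elim: (l - k)%N => [|d IH] i j; first exact: hk1.
  have [s hs] := row0 i; rewrite addSn /=.
  by apply: ample_gle (gle_sum1 _ s); apply: ample_mull.
(* The first step out of [a] has total weight at least 2, and each continuation of length [k]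
   reaches every group element. *)
have a2 j : ample 2 (walk B k.+1 a j).
  move=> g; apply: leq_trans ha _; rewrite /= sumZpGE; apply: leq_sum => s _.
  rewrite ffunE; apply: leq_sum => h _; rewrite -[X in (X <= _)%N]muln1.
  by apply: leq_mul => //; apply: hk1.
have hl2 l i : (k + k.+1 <= l)%N -> ample 2 (walk B l i a).
  move=> hl; have hl1 : (k.+1 <= l)%N by lia.
  rewrite -(subnK hl1); apply: ample_gle (gle_walk _ _ _ _ a _).
  by apply: ample_mull => //; apply: (@ample_neq0 _ 0%N); apply: hk2; lia.
have [rho0 [rho1 [rho r0 r1]]] := split_unit ha.
(* A walk to [None] is one step followed by a walk of A to [a], so the threshold [k + k.+1] of [hl2]
   goes up by one. *)
have [||| T [A' [x [e hx]]]] := @marked_presentation gT _ (out_split B a rho0 rho1) None (k + k.+2)%N.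
- by lia.
- case=> [|l] hl; first by lia.
  rewrite walk_out_split //; have [t ht] := r1.
  apply: ample_gle (gle_sum1 _ t); apply: ample_mull => //; apply: hl2; lia.
- apply: first_return_out_split_infinite => // t; exists k => //.
  exact: (@ample_neq0 _ 0%N).
exists T, A', x; split=> //.
apply: SSE_trans (SSE_step (ESSE_mxf A)) _.
by apply: SSE_trans (SSE_step (out_split_ESSE rho)) e.
Qed.
End FromPrimitive.

(** * Displacing a nonnegative matrix by a class of NK_1 *)

Lemma chain_twist_at0 (R : nzRingType) (W : finType) k D (pos : 'I_k -> 'I_D.+1 -> W)
    (u : W -> 'I_k -> R) :
  map_mx (coefp 0) (chain_twist pos u) = 1%:M.
Proof.
rewrite /chain_twist map_mxB map_mx1 map_mxM [map_mx _ (chain_out _ _)](_ : _ = 0).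
  by rewrite mulmx0 subr0.
apply/matrixP=> i w; rewrite !mxE /= coef_sum big1 // => l _.
by rewrite mulr_natl coefMn coefXn mul0rn.
Qed.

(* The chains [Some (Some i)] of [flat_graph] have rows [level l] times the sum  *)
(* of all group elements; [dented] adds to them the coefficients of [I - U(t^m)]. *)
Section Displacement.
Variable gT : finGroupType.
Local Notation S := (ZpG gT).
Local Notation ZZ := (ZG gT).

Definition flat (s : nat) : S := [ffun=> s].

(** With e the sum of all group elements, y e is the augmentation of y times e. *)
Lemma mul_flat (y : ZZ) s : augmentation y = 0 -> y * ZG_of (flat s) = 0.
Proof.
move=> y0; apply/ffunP=> g; rewrite !ffunE.
under eq_bigr => h _ do rewrite !ffunE.
by rewrite -mulr_suml -/(augmentation y) y0 mul0r.
Qed.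

Lemma augmentation_coef k (U : 'M[{poly ZZ}]_k) :
  map_mx (map_poly (@augmentation int gT)) U = 1%:M ->
  forall i j l, (0 < l)%N -> augmentation (U i j)`_l = 0.
Proof.
move=> U1 i j [//|l] _; have := congr1 (fun M : 'M[{poly int}]_k => (M i j)`_l.+1) U1.
by rewrite !mxE coef_map /= -polyC_natr coefC.
Qed.

Lemma coef_bound k (U : 'M[{poly ZZ}]_k) :
  exists s, forall i j l (g : gT), (absz (((U i j)`_l)%R g) <= s)%N.
Proof.
have [D hD] := poly_mx_size_bound U.
exists (\sum_i \sum_j \sum_(l < D) \sum_g absz (((U i j)`_l)%R g))%N => i j l g.
have [lD|Dl] := ltnP l D; last by rewrite nth_default ?ffunE // (leq_trans (hD i j)).
rewrite (bigD1 i) //= (bigD1 j) //= (bigD1 (Ordinal lD)) //= (bigD1 g) //=.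
by rewrite -!addnA leq_addr.
Qed.

Variables (T : finType) (A : T -> T -> S) (x : T).
Variables (k D s m : nat) (U : 'M[{poly ZZ}]_k).
Hypothesis Us : forall i j l (g : gT), (absz (((U i j)`_l)%R g) <= s)%N.
Hypothesis U1 : map_mx (map_poly (@augmentation int gT)) U = 1%:M.
Hypothesis U0 : map_mx (coefp 0) U = 1%:M.
Hypothesis m0 : (0 < m)%N.
Local Notation Um := (map_mx (psubst _ m) U).
Hypothesis UD : forall i j, (size (Um i j) <= D.+2)%N.
Hypothesis fA : forall l, (m <= l.+1)%N -> ample (k * s) (first_return A x l).

Local Notation W := ((option (option 'I_k) * 'I_D.+1) + T)%type.

Definition level (l : nat) : nat := if (m %| l.+1)%N then s else 0%N.
Definition loops (i : option 'I_k) (l : nat) : S :=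
  if i is Some _ then flat (level l)
  else [ffun g => (first_return A x l g - k * level l)%N].
Definition exits (i : option 'I_k) (t : T) : S :=
  if i is Some _ then 0 else excursion A x D.+1 t.

Definition flat_graph : W -> W -> S := split_graph A x loops exits.

(** The level is nonzero only if m divides l + 1, hence m <= l + 1; there [fA] makes the truncated
    subtraction in [loops] exact. *)
Lemma flat_graph_SSE : SSE (mxf A) (mxf flat_graph).
Proof.
apply: split_graph_SSE => [l lD|t]; rewrite big_option /=; last first.
  by rewrite big1 ?addr0.
have hf : ample (k * level l) (first_return A x l).
  rewrite /level; case: ifP => [h|_ g]; last by rewrite muln0.
  by apply: fA; apply: dvdn_leq.
move: (first_return A x l) hf => fr hf.
apply/ffunP=> g; rewrite [LHS]ffunE [X in X + _]ffunE sumZpGE.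
under eq_bigr => i _ do rewrite ffunE.
rewrite sum_nat_const card_ord; exact: subnK.
Qed.

Definition pos (i : 'I_k) (l : 'I_D.+1) : W := inl (Some (Some i), l).
Definition coefs (l : 'I_D.+1) (i j : 'I_k) : ZZ := - (Um i j)`_l.+1.
Definition dent (w : W) (j : 'I_k) : ZZ :=
  if w is inl (Some (Some i), l) then coefs l i j else 0.
Definition flat_row (i : 'I_k) (l : 'I_D.+1) (w : W) : ZZ :=
  if w is inl (Some _, l') then (l' == 0%N :> nat)%:R * ZG_of (flat (level l)) else 0.
Local Notation M := (fun w w' => ZG_of (flat_graph w w')).
Local Notation N := (chain_add pos dent M).

Lemma coefsE l i j : coefs l i j =
  if (m %| l.+1)%N then - (U i j)`_(l.+1 %/ m) else 0.
Proof.
by rewrite /coefs mxE psubstE coef_comp_poly_Xn //; case: ifP; rewrite ?oppr0.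
Qed.

Lemma augmentation_coefs l i j : augmentation (coefs l i j) = 0.
Proof.
rewrite coefsE; case: ifP => h; last by rewrite raddf0.
by rewrite raddfN /= augmentation_coef ?oppr0 // divn_gt0 // dvdn_leq.
Qed.

Lemma augmentation_dent w j : augmentation (dent w j) = 0.
Proof.
by case: w => [[[[i|]|] l]|t] /=; rewrite ?augmentation_coefs ?raddf0.
Qed.

Lemma flat_graph_pos i l w : M (pos i l) w =
  \sum_(l' < D.+1 | l' == l.+1 :> nat) (w == pos i l')%:R + flat_row i l w.
Proof.
rewrite /flat_graph /split_graph /= rmorphD rmorphM /= addrC; congr (_ + _); last first.
  case: w => [[[i'|] l']|t] /=; rewrite ?raddf0 ?mulr0 //.
  by rewrite rmorph_nat mulr_natl mulr_natr.
have [lD|Dl] := ltnP l.+1 D.+1; last first.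
  rewrite big_pred0 => [|l']; last by rewrite ltn_eqF // (leq_trans (ltn_ord l')).
  by case: w => [w|t] /=; rewrite raddf0.
rewrite (big_pred1 (Ordinal lD)) => [|l' //].
case: w => [[i' l']|t] /=; last by rewrite raddf0.
by rewrite rmorph_nat.
Qed.

Lemma dent_flat_row w l w' : \sum_j dent w j * flat_row j l w' = 0.
Proof.
apply: big1 => j _; case: w' => [[[i'|] l']|t] /=; rewrite ?mulr0 //.
by rewrite mulr_natl mulrnAr mul_flat ?mul0rn // augmentation_dent.
Qed.

(** Only edges from a displaced chain to the start of a displaced chain change. If m divides l + 1,
    such an edge has weight s e and s bounds the coefficients of [U]; otherwise the added
    coefficient is zero. *)
Lemma dented_ge0 w w' g : 0 <= N w w' g.
Proof.
have M0 : 0 <= M w w' g by rewrite ffunE.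
rewrite /chain_add; case: (pickP (fun j => w' == pos j ord0)) => [j /eqP ej|hn]; last first.
  rewrite big1 ?addr0 // => j _; by rewrite hn mulr0.
rewrite (bigD1 j) //= ej eqxx mulr1 big1 ?addr0 => [|j' /negPf hj]; last first.
  rewrite (_ : pos j ord0 == pos j' ord0 = false) ?mulr0 //.
  by apply/eqP => -[e]; rewrite e eqxx in hj.
case: w M0 => [[[[i|]|] l]|t] M0; try by rewrite addr0 -ej.
rewrite (flat_graph_pos i l) /= mul1r.
rewrite big1 ?add0r => [|l' /eqP hl]; last first.
  case: eqP => // e.
  by have := congr1 (fun w : W => if w is inl (_, l0) then val l0 else 0%N) e; rewrite /= hl.
rewrite coefsE /level; case: ifP => _; last by rewrite addr0 !ffunE.
rewrite [X in _ <= X]ffunE [X in X + _]ffunE [X in X%:Z]ffunE [X in _ + X]ffunE subr_ge0.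
by apply: le_trans (ler_norm _) _; rewrite -abszE lez_nat.
Qed.

(** The absolute value only retypes the nonnegative entries of [N] over Z_+G. *)
Definition dented (w w' : W) : S := [ffun g => `|N w w' g|%N].

Lemma ZG_of_dented w w' : ZG_of (dented w w') = N w w'.
Proof. by apply/ffunP=> g; rewrite [LHS]ffunE [X in X%:Z]ffunE gez0_abs //; apply: dented_ge0. Qed.

Lemma augmentation_dented w w' :
  augmentation (dented w w') = augmentation (flat_graph w w').
Proof.
suff [] : (augmentation (dented w w'))%:Z = (augmentation (flat_graph w w'))%:Z by [].
rewrite -!augmentation_ZG_of ZG_of_dented /chain_add rmorphD rmorph_sum big1 ?addr0 // => j _.
by rewrite rmorphM /= augmentation_dent mul0r.
Qed.

Lemma dented_displaced : invertible U -> exists V : 'M[{poly ZZ}]_#|{: W}|,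
  [/\ invertible V, map_mx (coefp 0) V = 1%:M, El_equiv V Um &
    V *m I_sub_tmx (map_mx (@ZG_of gT) (mxf flat_graph)) =
      I_sub_tmx (map_mx (@ZG_of gT) (mxf dented))].
Proof.
move=> Ui; exists (chain_twist pos dent).
have upos i l j : dent (pos i l) j = coefs l i j by [].
have eU : chain_poly coefs = Um by apply: chain_poly_coef => //; rewrite psubst_at0.
split.
- by apply: (chain_twist_invertible upos); rewrite eU; apply: invertible_map.
- exact: chain_twist_at0.
- by rewrite -eU; apply: chain_twist_equiv.
rewrite !map_mxf (chain_twistM flat_graph_pos dent_flat_row).
by congr I_sub_tmx; apply: eq_mxf => w w'; rewrite ZG_of_dented.
Qed.
End Displacement.

(** * Shift equivalence over semirings *)

Section ShiftEquivalenceFacts.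
Variable S : pzSemiRingType.

Lemma expmx_comm m n (A : 'M[S]_m) (B : 'M[S]_n) (U : 'M[S]_(m, n)) l :
  A *m U = U *m B -> A ^+ l *m U = U *m B ^+ l.
Proof.
move=> AU; elim: l => [|l IH]; first by rewrite !expr0 mul1mx mulmx1.
by rewrite !exprSr -!mulmxE -mulmxA AU mulmxA IH mulmxA.
Qed.

Lemma SE_trans m n p (A : 'M[S]_m) (B : 'M[S]_n) (C : 'M[S]_p) :
  SE A B -> SE B C -> SE A C.
Proof.
move=> [l1 [U1 [V1 [l1gt [A1 B1 AU VA]]]]] [l2 [U2 [V2 [l2gt [B2 C2 BU VB]]]]].
exists (l1 + l2)%N, (U1 *m U2), (V2 *m V1); rewrite addn_gt0 l1gt; split=> //; split.
- rewrite mulmxA -(mulmxA U1) -B2 -(expmx_comm l2 AU) -mulmxA -A1.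
  by rewrite addnC exprD mulmxE.
- rewrite mulmxA -(mulmxA V2) -B1 -(expmx_comm l1 (esym VB)) -mulmxA.
  by rewrite -C2 exprD mulmxE.
- by rewrite mulmxA AU -!mulmxA BU.
- by rewrite -mulmxA VA !mulmxA VB.
Qed.

Lemma SSE_SE m n (A : 'M[S]_m) (B : 'M[S]_n) : SSE A B -> SE A B.
Proof.
elim=> {m n A B} [m n A B [U [V [-> ->]]]|m n A B p C _ h1 _ h2].
  by exists 1%N, U, V; split=> //; split; rewrite ?expr1 ?mulmxA.
exact: SE_trans h1 h2.
Qed.

Lemma SE_of_eventual_absorption n (A B : 'M[S]_n) q0 :
  (forall q, (q0 <= q)%N -> B *m A ^+ q = A ^+ q.+1) ->
  (forall q, (q0 <= q)%N -> A *m B ^+ q = B ^+ q.+1) -> SE B A.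
Proof.
move=> BA AB; pose q := q0.+1.
have BAi i : B ^+ i *m A ^+ q = A ^+ (i + q).
  elim: i => [|i IH]; first by rewrite expr0 mul1mx.
  by rewrite exprS -mulmxE -mulmxA IH BA // ltnW // ltn_addl.
have ABi i : A ^+ i *m B ^+ q = B ^+ (i + q).
  elim: i => [|i IH]; first by rewrite expr0 mul1mx.
  by rewrite exprS -mulmxE -mulmxA IH AB // ltnW // ltn_addl.
exists (q + q)%N, (A ^+ q), (B ^+ q); split=> //; split.
- by rewrite ABi.
- by rewrite BAi.
- by rewrite BA ?exprSr ?mulmxE // ltnW.
- by rewrite AB ?exprSr ?mulmxE // ltnW.
Qed.

(** A state with zero column is deleted through the factorization of [M] into [M] without that
    column and the identity without that row; zero rows are dual. Splitting leaves such states, and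
    they would prevent primitivity. *)
Lemma SSE_trim n (M : 'M[S]_n) :
  exists n' (M' : 'M[S]_n'), [/\ SSE M' M,
    forall i, exists j, M' i j != 0 & forall j, exists i, M' i j != 0].
Proof.
elim: n M => [|n IH] M; first by exists 0%N, M; split; [exact: SSE_refl|case|case].
have [hc|hc] := pselect (forall j, exists i, M i j != 0); last first.
  have [j0 hj0] : exists j0, forall i, M i j0 = 0.
    apply: contrapT => hn; apply: hc => j; apply: contrapT => hj; apply: hn; exists j => i.
    by apply/eqP; apply: contrapT => hi; apply: hj; exists i; apply/negP.
  have [n' [M' [h1 h2 h3]]] := IH (row' j0 (col' j0 M)); exists n', M'; split=> //.
  apply: SSE_trans h1 _; apply: SSE_step; apply: ESSE_sym.
  exists (col' j0 M), (row' j0 1%:M); split; apply/matrixP=> i j; rewrite !mxE.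
    case: (unliftP j0 j) => [j'|] ->.
      rewrite (bigD1 j') //= !mxE eqxx mulr1 big1 ?addr0 // => k /negPf h.
      by rewrite !mxE (inj_eq lift_inj) h mulr0.
    rewrite hj0 big1 // => k _; rewrite !mxE eq_sym (negPf (neq_lift _ _)).
    by rewrite mulr0.
  rewrite (bigD1 (lift j0 i)) //= !mxE eqxx mul1r big1 ?addr0 // => k /negPf h.
  by rewrite !mxE eq_sym h mul0r.
have [hr|hr] := pselect (forall i, exists j, M i j != 0).
  by exists n.+1, M; split=> //; apply: SSE_refl.
have [i0 hi0] : exists i0, forall j, M i0 j = 0.
  apply: contrapT => hn; apply: hr => i; apply: contrapT => hi; apply: hn; exists i => j.
  by apply/eqP; apply: contrapT => hj; apply: hi; exists j; apply/negP.
have [n' [M' [h1 h2 h3]]] := IH (row' i0 (col' i0 M)); exists n', M'; split=> //.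
apply: SSE_trans h1 _; apply: SSE_step; apply: ESSE_sym.
exists (col' i0 1%:M), (row' i0 M); split; apply/matrixP=> i j; rewrite !mxE.
  case: (unliftP i0 i) => [i'|] ->.
    rewrite (bigD1 i') //= !mxE eqxx mul1r big1 ?addr0 // => k /negPf h.
    by rewrite !mxE (inj_eq lift_inj) eq_sym h mul0r.
  by rewrite hi0 big1 // => k _; rewrite !mxE (negPf (neq_lift _ _)) mul0r.
rewrite (bigD1 (lift i0 j)) //= !mxE eqxx mulr1 big1 ?addr0 // => k /negPf h.
by rewrite !mxE h mulr0.
Qed.
End ShiftEquivalenceFacts.

Lemma map_ESSE (S S' : nzSemiRingType) (f : {rmorphism S -> S'}) m n
  (A : 'M[S]_m) (B : 'M[S]_n) : ESSE A B -> ESSE (map_mx f A) (map_mx f B).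
Proof. by case=> U [V [-> ->]]; exists (map_mx f U), (map_mx f V); rewrite !map_mxM. Qed.

Lemma map_SSE (S S' : nzSemiRingType) (f : {rmorphism S -> S'}) m n
  (A : 'M[S]_m) (B : 'M[S]_n) : SSE A B -> SSE (map_mx f A) (map_mx f B).
Proof.
elim=> {m n A B} [m n A B /(map_ESSE f)|m n A B p C _ h1 _ h2]; first exact: SSE_step.
exact: SSE_trans h1 h2.
Qed.

Lemma map_expmx (S S' : nzSemiRingType) (f : {rmorphism S -> S'}) n (A : 'M[S]_n) l :
  map_mx f (A ^+ l) = (map_mx f A) ^+ l.
Proof.
elim: l => [|l IH]; first by rewrite !expr0 -[1]/(1%:M) map_mx1.
by rewrite !exprS -!mulmxE map_mxM IH.
Qed.

Section GroupRingSE.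
Variable gT : finGroupType.
Local Notation S := (ZpG gT).

Lemma SE_of_I_sub_tmx n (A B : 'M[S]_n) (V : 'M[{poly ZG gT}]_n) : invertible V ->
  V *m I_sub_tmx (map_mx (@ZG_of gT) A) = I_sub_tmx (map_mx (@ZG_of gT) B) -> SE B A.
Proof.
move=> [V' VV' V'V] e; have e' : V' *m I_sub_tmx (map_mx (@ZG_of gT) B) = I_sub_tmx (map_mx (@ZG_of gT) A).
  by rewrite -e mulmxA V'V mul1mx.
have inj : injective (map_mx (@ZG_of gT) : 'M_n -> 'M_n).
  move=> X Y /matrixP h; apply/matrixP=> i j; apply: ZG_of_inj.
  by have := h i j; rewrite !mxE.
have [q1 h1] := I_sub_tmx_intertwine e; have [q2 h2] := I_sub_tmx_intertwine e'.
apply: (@SE_of_eventual_absorption _ _ _ _ (maxn q1 q2)) => q; rewrite geq_max => /andP[hq1 hq2].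
  by apply: inj; rewrite map_mxM !map_expmx; apply: h1.
by apply: inj; rewrite map_mxM !map_expmx; apply: h2.
Qed.

(** B^(k+l) = U A^k V. As B has no zero row or column, neither has B^l = UV, so every row of [U] and
    every column of [V] is nonzero. *)
Lemma SE_primitive m n (B : 'M[S]_m) (A : 'M[S]_n) : SE B A -> G_primitive A ->
  (forall i, exists j, B i j != 0) -> (forall j, exists i, B i j != 0) -> G_primitive B.
Proof.
move=> [l [U [V [l0 [BUV AVU BU VB]]]]] [k k0 hk] hr hc.
have rows i p : exists j, (B ^+ p) i j != 0.
  elim: p i => [|p IH] i; first by exists i; rewrite expr0 mxE eqxx oner_neq0.
  have [j hj] := hr i; have [j' hj'] := IH j; exists j'.
  by rewrite exprS -mulmxE mxE; apply: (sum_neq0 (i := j)); apply: mul_neq0.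
have cols j p : exists i, (B ^+ p) i j != 0.
  elim: p j => [|p IH] j; first by exists j; rewrite expr0 mxE eqxx oner_neq0.
  have [i hi] := hc j; have [i' hi'] := IH i; exists i'.
  by rewrite exprSr -mulmxE mxE; apply: (sum_neq0 (i := i)); apply: mul_neq0.
exists (k + l)%N; first by rewrite addn_gt0 k0.
move=> i j; have -> : B ^+ (k + l) = U *m (A ^+ k *m V).
  by rewrite exprD BUV -mulmxE mulmxA (expmx_comm k BU) mulmxA.
have [j1] := rows i l; rewrite BUV mxE => /sum_neq0_ex[s /factor_neq0[Us _]].
have [i1] := cols j l; rewrite BUV mxE => /sum_neq0_ex[t /factor_neq0[_ Vt]].
suff h : ample 1 ((U *m (A ^+ k *m V)) i j) by [].
rewrite mxE; apply: ample_gle (gle_sum1 _ s); apply: ample_mull => //.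
rewrite mxE; apply: ample_gle (gle_sum1 _ t); apply: ample_mulr => // g.
Qed.
End GroupRingSE.

(** * Determinants *)

Section Determinants.
Variable R : comNzRingType.

Lemma det_El n (E : 'M[R]_n) : El E -> \det E = 1.
Proof.
elim=> [|i j r E' ij _ IH]; first exact: det1.
rewrite det_mulmx IH mulr1.
(* [C] is the identity with row [i] replaced by row [j]. It has two equal rows, and the transvection
   differs from the identity by [r] times its row [i]. *)
pose C : 'M[R]_n := \matrix_(k, l) (if k == i then j == l else k == l)%:R.
have li k : (lift i k == i) = false by rewrite eq_sym (negPf (neq_lift _ _)).
rewrite (@determinant_multilinear _ _ _ 1%:M C i 1 r).
- rewrite det1 (@determinant_alternate _ _ C i j) ?mulr0 ?mulr1 ?addr0 //.
  by move=> l; rewrite !mxE eqxx [j == i]eq_sym (negPf ij).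
- by apply/rowP=> l; rewrite !mxE eqxx mul1r [l == j]eq_sym.
- by apply/matrixP=> k l; rewrite !mxE li /= mulr0 addr0.
- by apply/matrixP=> k l; rewrite !mxE li /= mulr0 addr0.
Qed.

Lemma det_stab n N (A : 'M[R]_n) : (n <= N)%N -> \det (stab N A) = \det A.
Proof. by move=> nN; rewrite -(subnKC nN) stab_block det_ublock det1 mulr1. Qed.

Lemma det_El_equiv m n (A : 'M[R]_m) (B : 'M[R]_n) : El_equiv A B -> \det A = \det B.
Proof.
case=> N [E [F [mN nN hE hF e]]].
by rewrite -(det_stab A mN) e !det_mulmx (det_El hE) (det_El hF) mul1r mulr1 det_stab.
Qed.

Hypothesis reduced : forall x : R, x * x = 0 -> x = 0.

Lemma reduced_exp (x : R) n : x ^+ n = 0 -> x = 0.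
Proof.
have h k : x ^+ (2 ^ k) = 0 -> x = 0.
  elim: k => [|k IH]; first by rewrite expr1.
  by rewrite expnS mulnC exprM expr2 => /reduced.
by move=> xn; apply: (h n); rewrite -(subnK (ltnW (ltn_expl n (isT : 1 < 2)%N))) exprD xn mulr0.
Qed.

Lemma reduced_poly_unit (p q : {poly R}) : p * q = 1 -> p = (p`_0)%:P.
Proof.
move=> pq; apply: size1_polyC; rewrite leqNgt; apply/negP => p1.
case sp : (size p) p1 => [|[|n]] // _; pose a := lead_coef p.
have an : p`_n.+1 = a by rewrite /a lead_coefE sp.
have a0 : a != 0 by rewrite lead_coef_eq0 -size_poly_eq0 sp.
have kill i : forall j, (size q <= j + i)%N -> a ^+ i * q`_j = 0.
  elim: i => [|i IH] j hj; first by rewrite addn0 in hj; rewrite nth_default ?mulr0.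
  have := congr1 (fun s : {poly R} => a ^+ i * s`_(n.+1 + j)) pq.
  rewrite coef1 addSn mulr0 coefM (bigD1 (inord n.+1)) //= inordK; last by rewrite !ltnS leq_addr.
  rewrite an subSS addKn mulrDr mulrA -exprSr mulr_sumr big1 ?addr0 // => k hk.
  have hkn : k != n.+1 :> nat.
    by apply: contraNneq hk => <-; rewrite inord_val.
  have [kn|nk] := ltnP k n.+1.
    rewrite mulrCA IH ?mulr0 //; lia.
  by rewrite nth_default ?mul0r ?mulr0 // sp ltn_neqAle eq_sym hkn.
have aq : a ^+ size q * q`_0 = 0 by apply: kill; rewrite add0n.
have pq0 : p`_0 * q`_0 = 1 by rewrite -coef0M pq coef1.
have : a ^+ size q = 0 by rewrite -[LHS]mulr1 -pq0 mulrCA aq mulr0.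
by move/reduced_exp/eqP; rewrite (negPf a0).
Qed.
End Determinants.

(** The two determinants differ by the factor det U, a unit of R[t]; over a reduced ring it is
    constant, hence equal to det U(0) = 1. *)
Lemma det_displaced (R : comNzRingType) b n k (B : 'M[R]_b) (A : 'M[R]_n) (U : 'M[{poly R}]_k) :
  (forall x : R, x * x = 0 -> x = 0) -> invertible U -> map_mx (coefp 0) U = 1%:M ->
  displaced B A U -> \det (I_sub_tmx B) = \det (I_sub_tmx A).
Proof.
move=> red [U' UU' _] U0 [w [V [A' [_ _ VU eA eB]]]].
rewrite (det_El_equiv eB) det_mulmx (det_El_equiv VU) (det_El_equiv eA).
have e1 : \det U * \det U' = 1 by rewrite -det_mulmx UU' det1.
rewrite (reduced_poly_unit red e1).
have -> : (\det U)`_0 = \det (map_mx (coefp 0) U) by rewrite (det_map_mx (coefp 0)).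
by rewrite U0 det1 mul1r.
Qed.

Section Commutative.
Variable gT : finGroupType.
Local Notation ZZ := (ZG gT).

Definition star (x : ZZ) : ZZ := [ffun g => x g^-1%g].

Lemma starM x y : star (x * y) = star y * star x.
Proof.
apply/ffunP=> g; rewrite !ffunE (reindex_inj (mulgI g^-1%g)) /=; apply: eq_bigr => h _.
by rewrite !ffunE !invMg !invgK mulrC; congr (y _ * x _); rewrite -mulgA mulgV mulg1.
Qed.

(** The coefficient of x x* at the neutral element is the sum of the squares of the coefficients of
    x. *)
Lemma star_sqr_eq0 x : x * star x = 0 -> x = 0.
Proof.
move/ffunP/(_ 1%g); rewrite !ffunE => /eqP; rewrite psumr_eq0 => [/allP h|g _].
  apply/ffunP=> g; rewrite ffunE; apply/eqP.
  have := h g (mem_index_enum _); rewrite ffunE mulg1 invgK /=.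
  by rewrite -expr2 sqrf_eq0.
by rewrite ffunE mulg1 invgK -expr2 sqr_ge0.
Qed.

Hypothesis abG : abelian [set: gT]%SET.

Lemma ZG_mulC : commutative (@GRing.mul ZZ).
Proof.
move=> x y; apply/ffunP=> g; rewrite !ffunE (reindex_inj invg_inj) (reindex_inj (mulgI g^-1%g)) /=.
apply: eq_bigr => h _; rewrite invMg invgK mulrC invMg invgK.
have c (a b : gT) : (a * b = b * a)%g.
  exact: (centsP abG a (finset.in_setT a) b (finset.in_setT b)).
by congr (y _ * x _); rewrite -mulgA (c h) mulKg.
Qed.

(** With y = x x*, y* = y and commutativity gives y y* = x x x* x* = 0; positivity gives y = 0 and
    then x = 0. *)
Lemma ZG_reduced (x : ZZ) : x * x = 0 -> x = 0.
Proof.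
move=> xx; apply: star_sqr_eq0; apply: star_sqr_eq0.
rewrite starM (_ : star (star x) = x); last by apply/ffunP=> g; rewrite !ffunE invgK.
by rewrite mulrA -(mulrA x) (ZG_mulC (star x)) mulrA xx !mul0r.
Qed.

Lemma ZG_det_displaced b n k (B : 'M[ZZ]_b) (A : 'M[ZZ]_n) (U : 'M[{poly ZZ}]_k) :
  invertible U -> map_mx (coefp 0) U = 1%:M ->
  displaced B A U -> \det (I_sub_tmx B) = \det (I_sub_tmx A).
Proof.
(* The commutative structure is put on the same carrier and operations, so the statement over [Rc]
   is convertible to the goal. *)
pose Rc : comNzRingType := HB.pack (grpring int gT)
  (GRing.PzRing_hasCommutativeMul.Build (grpring int gT) ZG_mulC).
exact: (@det_displaced Rc b n k B A U ZG_reduced).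
Qed.
End Commutative.

(** * Construction of the family *)

Lemma displaced_primitive_matrix (gT : finGroupType) n (A : 'M[ZpG gT]_n) (lambda : algC)
    k (U : 'M[{poly ZG gT}]_k) :
  G_primitive A -> is_spectral_radius (map_mx (@ZG_of gT) A) lambda -> 1 < lambda ->
  invertible U -> map_mx (coefp 0) U = 1%:M ->
  map_mx (map_poly (@augmentation int gT)) U = 1%:M ->
  exists m0, forall m, (m0 < m)%N -> exists b (B : 'M[ZpG gT]_b),
    [/\ G_primitive B, SE B A,
      SSE (map_mx (@augmentation nat gT) B) (map_mx (@augmentation nat gT) A) &
      displaced (map_mx (@ZG_of gT) B) (map_mx (@ZG_of gT) A) (map_mx (psubst _ m) U)].
Proof.
move=> Ap hsr l1 Ui U0 U1.
have [T [A' [x [AA' hx]]]] := primitive_presentation Ap hsr l1.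
(* The threshold [m0] makes first returns ample enough for [k] rows of level [s]. It does not depend
   on [m], as [U] and U(t^m) have the same coefficients up to position. *)
have [s Us] := coef_bound U; have [m0 hm0] := hx (k * s)%N.
exists m0 => m mm0; have m_gt0 : (0 < m)%N by apply: leq_ltn_trans mm0.
have [D hD] := poly_mx_size_bound (map_mx (psubst _ m) U).
have UD i j : (size (map_mx (psubst _ m) U i j) <= D.+2)%N.
  by apply: leq_trans (hD i j) _; rewrite ltnW.
have fA l : (m <= l.+1)%N -> ample (k * s) (first_return A' x l).
  by move=> ml; apply: hm0; rewrite -ltnS; apply: leq_trans mm0 ml.
pose A3 := mxf (@flat_graph _ _ A' x k D s m); pose B0 := mxf (@dented _ _ A' x k D s m U).
have AA3 : SSE A3 A.
  apply: SSE_sym; apply: SSE_trans AA' _; exact: flat_graph_SSE.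
have [V [Vi V0 VU VA3]] := dented_displaced A' x Us U1 U0 m_gt0 UD Ui.
have [b [B [BB0 Br Bc]]] := SSE_trim B0.
have BA : SE B A.
  apply: SE_trans (SSE_SE BB0) _; apply: SE_trans (SSE_SE AA3).
  exact: SE_of_I_sub_tmx Vi VA3.
exists b, B; split=> //.
- exact: SE_primitive BA Ap Br Bc.
- apply: SSE_trans (map_SSE (@augmentation nat gT) BB0) _.
  have -> : map_mx (@augmentation nat gT) B0 = map_mx (@augmentation nat gT) A3.
    by rewrite !map_mxf; apply: eq_mxf => w w'; apply: augmentation_dented.
  exact: (map_SSE (@augmentation nat gT) AA3).
exists _, V, (map_mx (@ZG_of gT) A3); split=> //.
  exact: SSE_El_equiv (map_SSE (@ZG_of gT) AA3).
rewrite VA3; exact: SSE_El_equiv (map_SSE (@ZG_of gT) BB0).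
Qed.

Theorem theorem5p2 (gT : finGroupType) (n : nat) (A : 'M[ZpG gT]_n)
    (lambda : algC) :
  NK1 (ZG gT) <> [set K1_0 {poly ZG gT}] ->
  G_primitive A ->
  is_spectral_radius (map_mx (@ZG_of gT) A) lambda ->
  1 < lambda ->
  elementary_stabilizer (map_mx (@ZG_of gT) A) = [set K1_0 {poly ZG gT}] ->
  exists (m : nat -> nat) (B : forall i : nat, 'M[ZpG gT]_(m i)),
    [/\ forall i : nat, G_primitive (B i),
        forall i j : nat, i <> j ->
          ~ SSE (map_mx (@ZG_of gT) (B i)) (map_mx (@ZG_of gT) (B j))
      & forall i : nat,
        [/\ SE (B i) A,
            SSE (map_mx (@augmentation nat gT) (B i))
                (map_mx (@augmentation nat gT) A)
          & abelian [set: gT]%SET ->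
            \det (I_sub_tmx (map_mx (@ZG_of gT) (B i)))
              = \det (I_sub_tmx (map_mx (@ZG_of gT) A))]].
Proof.
move=> nk Ap hsr l1 tr; have [k [U [Ui U0 U1 nU]]] := NK1_ZG_normalized nk.
have [m0 hB] := displaced_primitive_matrix Ap hsr l1 Ui U0 U1.
have /choice[next hnext] M : exists m, (M < m)%N /\ forall m', (0 < m' <= M)%N ->
    ~ El_equiv (map_mx (psubst _ m) U) (map_mx (psubst _ m') U).
  by have [m h1 h2] := psubst_infinite U0 Ui nU M; exists m.
(* Each exponent is chosen against all smaller positive ones, so the classes of U(t^([ms i])) are
   pairwise distinct. Starting with one application of [next] puts every [ms i] above [m0]. *)
pose ms i := iter i.+1 next m0.
have msS i : (ms i < ms i.+1)%N by have [] := hnext (ms i).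
have ms_mono i j : (i <= j)%N -> (ms i <= ms j)%N.
  move=> ij; rewrite -(subnK ij); elim: (j - i)%N => [|d IH] //.
  by apply: leq_trans IH (ltnW _); rewrite addSn; apply: msS.
have ms_gt i : (m0 < ms i)%N.
  by apply: leq_trans (ms_mono 0%N i (leq0n i)); have [] := hnext m0.
have ms_neq i j : (i < j)%N ->
    ~ El_equiv (map_mx (psubst _ (ms j)) U) (map_mx (psubst _ (ms i)) U).
  case: j => // j; rewrite ltnS => ij; have [_] := hnext (ms j); apply.
  by rewrite (leq_ltn_trans _ (ms_gt i)) // ms_mono.
have /choice[f hf] i : exists F : {b & 'M[ZpG gT]_b}, let B := projT2 F in
    [/\ G_primitive B, SE B A,
      SSE (map_mx (@augmentation nat gT) B) (map_mx (@augmentation nat gT) A) &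
      displaced (map_mx (@ZG_of gT) B) (map_mx (@ZG_of gT) A) (map_mx (psubst _ (ms i)) U)].
  by have [b [B h]] := hB (ms i) (ms_gt i); exists (existT (fun b => 'M[ZpG gT]_b) b B).
exists (fun i => projT1 (f i)), (fun i => projT2 (f i)); split=> [i|i j ij|i].
- by have [] := hf i.
- have [_ _ _ di] := hf i; have [_ _ _ dj] := hf j.
  move=> /(displaced_class tr di dj) e.
  case: (ltngtP i j) => [lt|lt|//]; last exact: ms_neq lt e.
  exact: ms_neq lt (El_equiv_sym e).
have [_ h2 h3 h4] := hf i; split=> // abG.
apply: (ZG_det_displaced abG _ _ h4); first exact: invertible_map.
by rewrite psubst_at0 // (leq_ltn_trans _ (ms_gt i)).
Qed.
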